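(* Let $X$ be a finite graph and let $Y$ be a regular covering graph of $X$ with covering transformation group $\pi=\mathbb{Z}=\langle t\rangle$ (so $\mathbb{Z}$ acts freely on $Y$ with quotient $X$). Let $P_u(x)$ be the polynomial in $x$ (of degree $n$, with coefficients polynomials in $u$) such that \[ \det \Delta_u = P_u\!\left(\frac{t+t^{-1}}{2}\right). \] Then there is $R>0$ such that for all $0<|u|<R$ one can write $P_u(x) = \alpha(u)\prod_{i=1}^{n}(r_i(u)-x)$, where $r_1(u),\dots,r_n(u)$ are the roots of $P_u$, and \[ Z^{(2)}_Y(u)^{-1} = (1-u^2)^{-\chi(X)}\,\frac{\alpha(u)}{2^{n}}\prod_{i=1}^{n}\Bigl(r_i + \sqrt{r_i+1}\,\sqrt{r_i-1}\Bigr), \] where the square roots are principal, $\sqrt{z}=\exp(\tfrac12\log z)$ with $\log$ the principal logarithm.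
   Context: Let $Y=(VY,EY)$ be a locally finite graph with a free action of $\pi=\mathbb{Z}=\langle t\rangle$ whose quotient $X=Y/\mathbb{Z}$ is a finite graph; $\chi(X)$ is its Euler characteristic (vertices minus edges). Let $P$ be the set of free homotopy classes of primitive closed paths in $Y$; for $\gamma\in P$, $\mathrm{len}(\gamma)$ is the length of a shortest representative and $\pi_\gamma$ is the stabilizer of $\gamma$ in $\pi$. The $L^2$ zeta function of $Y$ is \[ Z^{(2)}_Y(u)^{-1} = \prod_{\gamma\in \pi\backslash P}\bigl(1-u^{\mathrm{len}(\gamma)}\bigr)^{1/|\pi_\gamma|}, \] which converges for small $|u|$. Choose a lift in $Y$ of each of the $v$ vertices of $X$; this identifies $\ell^2(VY)$ with $\bigoplus_{v}\ell^2(\mathbb{Z})$, so the adjacency operator $\delta$ of $Y$ becomes a $v\times v$ matrix with entries in the group ring $\mathbb{Z}[t,t^{-1}]$. Let $Q$ be the diagonal matrix with entry $q(w)$ at vertex $w$, where $q(w)+1$ is the degree of $w$. Put $\Delta_u = I - \delta u + Q u^2$, a $v\times v$ matrix over $\mathbb{Z}[u][t,t^{-1}]$. Its determinant $\det\Delta_u$ is a Laurent polynomial in $t$ symmetric under $t\leftrightarrow t^{-1}$, hence equals $P_u\bigl(\frac{t+t^{-1}}{2}\bigr)$ for a unique polynomial $P_u(x)$ whose coefficients are integer polynomials in $u$; it does not depend on the choice of lifts. $n$ denotes the degree of $P_u$ in $x$. *)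

(* Defs.v *)
From HB Require Import structures.
From mathcomp Require Import all_boot all_order all_algebra fraction.
From mathcomp Require Import finmap complex.
From mathcomp Require Import boolp classical_sets functions cardinality fsbigop.
From mathcomp Require Import reals topology normedtype sequences exp trigo.
Set Implicit Arguments.
Unset Strict Implicit.
Unset Printing Implicit Defensive.

Import Order.TTheory GRing.Theory Num.Theory.
Import numFieldNormedType.Exports.

Local Open Scope classical_set_scope.
Local Open Scope ring_scope.

(* Graphs in the sense of Serre: [E] is the set of oriented edges, [einv]
   reverses orientation, and a geometric edge is a pair {e, einv e}.  Loops and
   multiple edges are allowed. *)
Record graph (V E : choiceType) := Graph {
  org : E -> V;
  einv : E -> E;
  einvK : involutive einv;
  einv_neq : forall e, einv e != e
}.

Definition term (V E : choiceType) (Y : graph V E) (e : E) : V :=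
  org Y (einv Y e).

Record graph_map (V E : choiceType) (Y : graph V E)
    (V' E' : choiceType) (X : graph V' E') := GraphMap {
  mapV : V -> V';
  mapE : E -> E';
  map_org : forall e, org X (mapE e) = mapV (org Y e);
  map_einv : forall e, einv X (mapE e) = mapE (einv Y e)
}.

(* Action of the infinite cyclic group <t> by graph automorphisms: [actV k] and
   [actE k] are the actions of t^k. *)
Record zaction (V E : choiceType) (Y : graph V E) := ZAction {
  actV : int -> V -> V;
  actE : int -> E -> E;
  actV0 : forall y, actV 0 y = y;
  actVD : forall k l y, actV (k + l) y = actV k (actV l y);
  actE0 : forall e, actE 0 e = e;
  actED : forall k l e, actE (k + l) e = actE k (actE l e);
  act_org : forall k e, org Y (actE k e) = actV k (org Y e);
  act_einv : forall k e, einv Y (actE k e) = actE k (einv Y e)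
}.

(* Freeness on edges follows from freeness on vertices. *)
Definition free_action (V E : choiceType) (Y : graph V E) (a : zaction Y) : Prop :=
  forall k y, actV a k y = y -> k = 0.

(* [p] identifies X with the quotient graph Y / <t>. *)
Definition quotient_map (V E : choiceType) (Y : graph V E) (a : zaction Y)
    (V' E' : choiceType) (X : graph V' E') (p : graph_map Y X) : Prop :=
  [/\ forall x, exists y, mapV p y = x,
      forall f, exists e, mapE p e = f,
      forall y y', mapV p y = mapV p y' <-> exists k, y' = actV a k y
    & forall e e', mapE p e = mapE p e' <-> exists k, e' = actE a k e].

Definition euler_char (V E : finType) (X : graph V E) : int :=
  #|V|%:Z - (#|E|./2)%:Z.

(** * Closed paths and free homotopy *)

Fixpoint walk (V E : choiceType) (Y : graph V E) (v : V) (s : seq E) (w : V)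
    : bool :=
  if s is e :: s' then (org Y e == v) && walk Y (term Y e) s' w else v == w.

(* A closed path is given by its base vertex and its sequence of edges; the
   base vertex is only needed to tell constant paths apart. *)
Definition closed_path (V E : choiceType) (Y : graph V E) (c : V * seq E) : bool :=
  walk Y c.1 c.2 c.1.

Inductive free_homotopic (V E : choiceType) (Y : graph V E) :
    V * seq E -> V * seq E -> Prop :=
| fh_refl c : closed_path Y c -> free_homotopic Y c c
| fh_sym c d : free_homotopic Y c d -> free_homotopic Y d c
| fh_trans c d f : free_homotopic Y c d -> free_homotopic Y d f ->
    free_homotopic Y c f
| fh_backtrack v s1 s2 e :
    closed_path Y (v, s1 ++ s2) ->
    closed_path Y (v, s1 ++ [:: e; einv Y e] ++ s2) ->
    free_homotopic Y (v, s1 ++ [:: e; einv Y e] ++ s2) (v, s1 ++ s2)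
| fh_rotate v e s :
    closed_path Y (v, e :: s) ->
    free_homotopic Y (v, e :: s) (term Y e, rcons s e).

Definition path_pow (V E : choiceType) (c : V * seq E) (k : nat) : V * seq E :=
  (c.1, flatten (nseq k c.2)).

(* Primitivity is taken up to homotopy; constant paths, being their own
   squares, are not primitive. *)
Definition primitive_path (V E : choiceType) (Y : graph V E) (c : V * seq E)
    : Prop :=
  closed_path Y c /\
  forall d k, closed_path Y d -> (2 <= k)%N -> ~ free_homotopic Y c (path_pow d k).

Definition homotopy_class (V E : choiceType) (Y : graph V E) (c : V * seq E)
    : set (V * seq E) :=
  [set d | free_homotopic Y c d].

Definition primitive_classes (V E : choiceType) (Y : graph V E)
    : set (set (V * seq E)) :=
  [set homotopy_class Y c | c in primitive_path Y].

Definition class_len (V E : choiceType) (g : set (V * seq E)) : nat :=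
  xget 0%N [set n | (exists2 c, g c & size c.2 = n) /\
                    forall d, g d -> (n <= size d.2)%N].

Definition act_path (V E : choiceType) (Y : graph V E) (a : zaction Y) (k : int)
    (c : V * seq E) : V * seq E :=
  (actV a k c.1, map (actE a k) c.2).

Definition act_class (V E : choiceType) (Y : graph V E) (a : zaction Y) (k : int)
    (g : set (V * seq E)) : set (V * seq E) :=
  act_path a k @` g.

Definition class_stab (V E : choiceType) (Y : graph V E) (a : zaction Y)
    (g : set (V * seq E)) : set int :=
  [set k | act_class a k g = g].

Definition class_orbit (V E : choiceType) (Y : graph V E) (a : zaction Y)
    (g : set (V * seq E)) : set (set (V * seq E)) :=
  [set act_class a k g | k in [set: int]].

Definition primitive_orbits (V E : choiceType) (Y : graph V E) (a : zaction Y)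
    : set (set (set (V * seq E))) :=
  [set class_orbit a g | g in primitive_classes Y].

(** * Principal branches of complex functions *)

Definition cexp (R : realType) (z : R[i]) : R[i] :=
  (expR (complex.Re z))%:C%C *
  (cos (complex.Im z) +i* sin (complex.Im z))%C.

Definition cmod (R : realType) (z : R[i]) : R :=
  Num.sqrt (complex.Re z ^+ 2 + complex.Im z ^+ 2).

(* The argument in ]-pi, pi] of a nonzero complex number. *)
Definition carg (R : realType) (z : R[i]) : R :=
  if 0 <= complex.Im z then acos (complex.Re z / cmod z)
  else - acos (complex.Re z / cmod z).

Definition clog (R : realType) (z : R[i]) : R[i] :=
  (ln (cmod z) +i* carg z)%C.

Definition cpow (R : realType) (z a : R[i]) : R[i] :=
  if z == 0 then (a == 0)%:R else cexp (a * clog z).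

Definition csqrt (R : realType) (z : R[i]) : R[i] := cpow z (2%:R^-1).

(** * The L2 zeta function *)

(* Unordered products over a possibly infinite set D: limit of the finite
   partial products along the net of finite subsets of D. *)
Definition finite_subsets (I : choiceType) (D : set I) : set_system {fset I} :=
  filter_from [set A : {fset I} | [set` A] `<=` D]
    (fun A => [set B : {fset I} | (A `<=` B)%fset /\ [set` B] `<=` D]).

Definition partial_prod (R : realType) (I : choiceType) (f : I -> R[i])
    (A : {fset I}) : R[i] :=
  \prod_(i <- A) f i.

(* If the stabilizer is infinite then the cardinal below is 0, so the exponent
   is 0, in accordance with 1 / oo = 0. *)
Definition zeta_factor (R : realType) (V E : choiceType) (Y : graph V E)
    (a : zaction Y) (u : R[i]) (g : set (V * seq E)) : R[i] :=
  cpow (1 - u ^+ class_len g) ((#|` fset_set (class_stab a g)|%fset)%:R^-1).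

(* The length and the stabilizer are constant on orbits, so the choice of the
   representative does not matter. *)
Definition zeta_orbit_factor (R : realType) (V E : choiceType) (Y : graph V E)
    (a : zaction Y) (u : R[i]) (o : set (set (V * seq E))) : R[i] :=
  zeta_factor a u (xget set0 o).

Definition zeta_partial_prods (R : realType) (V E : choiceType) (Y : graph V E)
    (a : zaction Y) (u : R[i]) : set_system R[i]^o :=
  partial_prod (zeta_orbit_factor a u) @ finite_subsets (primitive_orbits a).

(* The inverse of the L2 zeta function; meaningful when the product converges,
   i.e. when [cvg (zeta_partial_prods a u)]. *)
Definition L2zeta_inv (R : realType) (V E : choiceType) (Y : graph V E)
    (a : zaction Y) (u : R[i]) : R[i] :=
  lim (zeta_partial_prods a u).

(** * The determinant of the Laplacian *)

(* Z[u][t, 1/t] is regarded as a subring of its fraction field. *)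
Definition laurent := {fraction {poly {poly int}}}.

Definition tvar : laurent := tofrac 'X.
Definition lconst (c : {poly int}) : laurent := tofrac c%:P.
Definition uvar : laurent := lconst 'X.

Definition adjacency (V E : choiceType) (Y : graph V E) (y y' : V) : nat :=
  #|` fset_set [set e | org Y e = y /\ term Y e = y']|%fset.

Definition degree (V E : finType) (X : graph V E) (w : V) : nat :=
  #|[set e | org X e == w]%SET|.

(* Matrix of the adjacency operator over the group ring: with respect to the
   lifts [s], the image of the basis vector [s w] has coefficient
   [adjacency (t^k s v) (s w)] on the vertex t^k s v.  Only finitely many terms
   of the sum are nonzero. *)
Definition adjacency_entry (V E : choiceType) (Y : graph V E) (a : zaction Y)
    (VX : finType) (s : VX -> V) (v w : VX) : laurent :=
  \sum_(k \in [set: int]) (adjacency Y (actV a k (s v)) (s w))%:R * tvar ^ k.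

Definition adjacency_mx (V E : choiceType) (Y : graph V E) (a : zaction Y)
    (VX : finType) (s : VX -> V) : 'M[laurent]_#|VX| :=
  \matrix_(i, j) adjacency_entry a s (enum_val i) (enum_val j).

Definition Q_mx (VX EX : finType) (X : graph VX EX) : 'M[laurent]_#|VX| :=
  diag_mx (\row_i ((degree X (enum_val i))%:R - 1)).

Definition Delta_mx (VX EX : finType) (X : graph VX EX)
    (V E : choiceType) (Y : graph V E) (a : zaction Y) (s : VX -> V)
    : 'M[laurent]_#|VX| :=
  1%:M - uvar *: adjacency_mx a s + uvar ^+ 2 *: Q_mx X.

(* P_u((t + 1/t)/2), for P a polynomial in x with coefficients in Z[u]. *)
Definition eval_at_cos (P : {poly {poly int}}) : laurent :=
  (map_poly lconst P).[(tvar + tvar^-1) / 2%:R].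

(* P_u for a complex value of u. *)
Definition specialize (R : realType) (P : {poly {poly int}}) (u : R[i])
    : {poly R[i]} :=
  map_poly (fun c : {poly int} => (map_poly intr c).[u]) P.

(* Main.v *)
(** Stabilizers are trivial, so the zeta function is [prod (1 - u^len)] over the
    translation orbits of primitive cycles.  Lifting the edges of [X] to edges of
    [Y] based at the chosen vertices gives each edge [f] a voltage [c f] in [Z];
    let [T z] be the non-backtracking edge matrix of [X] with [f] weighted by
    [z^(-c f)].  Bass' identity reads
    [det (1 - u T z) = (1 - u^2)^(-chi) P_u((z + 1/z)/2)], and writing the roots
    of [P_u] as [(w + 1/w)/2] with [|w| > 1], the right-hand side is
    [c prod (1 - z/w)(1 - 1/(z w))] where [c] is the right-hand side of the
    theorem.  The product over the [N]-th roots of unity [z] is thus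
    [c^N prod (1 - w^-N)^2].

    Averaging [tr (T z)^m] over the [N]-th roots of unity counts the cyclically
    reduced closed paths of length [m] in [Y] up to translation, as soon as [N]
    is large compared with [m].  Comparing logarithmic derivatives, the same
    product agrees, up to a power [u^M] with [M] proportional to [N], with the
    [N]-th power of [F_M], the product of [1 - u^len] over the orbits of length
    less than [M].  For small [u] this gives [(c / F_M)^N -> 1] for [N = M L + 1]
    and for [N = M L + 2], whence [F_M -> c]: no logarithm is needed. *)

Require Import Defs.
From HB Require Import structures.
From mathcomp Require Import all_boot all_order all_algebra fraction.
From mathcomp Require Import finmap complex.
From mathcomp Require Import boolp classical_sets functions cardinality fsbigop.
From mathcomp Require Import reals topology normedtype sequences exp trigo.
From mathcomp Require Import cyclic separable cyclotomic.
From mathcomp Require Import ring lra zify.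
Set Implicit Arguments.
Unset Strict Implicit.
Unset Printing Implicit Defensive.
Import Order.TTheory GRing.Theory Num.Theory.
Import numFieldNormedType.Exports.
Local Open Scope classical_set_scope.
Local Open Scope ring_scope.

(** * Spectra, logarithmic derivatives and coefficient norms *)

(** The analytic route would integrate the logarithm of the determinant over the circle. Staying
    with finite products has a price: an [N]-th power determines [c] only up to a root of unity.
    Dividing the relations for two consecutive exponents removes the ambiguity. The exponent [N]
    must grow linearly in [M]. It is at least [M L], so that a word shorter than [M] has voltage
    zero modulo [N] only if its voltage is zero. It is not much larger, because the gain
    [(|u|/rho0)^M] from divisibility by [X^M] has to beat the loss [(2 B)^N], which comes from the
    size of the two products and from the division by [F_M^N]. This balance fixes the radius. The
    principal roots only give [|w| >= 1]; strictness comes from the determinant having no zero on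
    the unit circle for small [u]. The point [u = 0] is left out because the leading coefficient of
    [P_u] may vanish there. *)

Section Spectrum.
Variable C : numClosedFieldType.

Lemma trigonalizableP n (A : 'M[C]_n) :
  exists P D : 'M[C]_n, [/\ P \in unitmx, is_trig_mx D & A = invmx P *m D *m P].
Proof.
case: n A => [|n] A.
  exists 1%:M, A; split; [exact: unitmx1 | | by rewrite mulmx1 invmx1 mul1mx].
  by apply/is_trig_mxP => -[].
have [P Punit Ptrig] := @Schur C n.+1 A isT.
have Pu := unitarymx_unit Punit.
exists P, (conjmx P A); split => //.
by rewrite conjumx // !mulmxA mulVmx // mul1mx -mulmxA mulVmx // mulmx1.
Qed.

Lemma trigM n (A B : 'M[C]_n) : is_trig_mx A -> is_trig_mx B ->
  is_trig_mx (A *m B) /\ forall i, (A *m B) i i = A i i * B i i.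
Proof.
move=> /is_trig_mxP At /is_trig_mxP Bt; split=> [|i].
  apply/is_trig_mxP => i j ij; rewrite mxE big1 // => k _.
  have [ik|ki] := ltnP i k; first by rewrite At ?mul0r.
  by rewrite Bt ?mulr0 // (leq_ltn_trans ki).
rewrite mxE (bigD1 i) //= big1 ?addr0 // => k /negPf ki.
have [ik|ki'|/val_inj e] := ltngtP i k; first by rewrite At ?mul0r.
  by rewrite Bt ?mulr0.
by rewrite e eqxx in ki.
Qed.

Lemma trigX n (A : 'M[C]_n) m : is_trig_mx A ->
  is_trig_mx (A ^+ m) /\ forall i, (A ^+ m) i i = A i i ^+ m.
Proof.
move=> At; elim: m => [|m [IHt IHd]].
  by split=> [|i]; rewrite expr0 ?scalar_mx_is_trig // mxE eqxx.
by have [Mt Md] := trigM At IHt; split=> [|i]; rewrite exprS // Md IHd -exprS.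
Qed.

Lemma conjX n (P D : 'M[C]_n) m : P \in unitmx ->
  (invmx P *m D *m P) ^+ m = invmx P *m D ^+ m *m P.
Proof.
move=> Pu; elim: m => [|m IH]; first by rewrite !expr0 mulmx1 mulVmx.
rewrite !exprS IH /GRing.mul /= !mulmxA.
by rewrite -[invmx P *m D *m P *m invmx P]mulmxA mulmxV // mulmx1.
Qed.

(** One list of eigenvalues has to serve three ends: the determinant as a product, the power traces
    as its logarithmic derivative, and a bound on each factor through an eigenvector. The diagonal
    of a triangular form provides it. *)
Lemma spectrum n (A : 'M[C]_n) : exists lam : 'I_n -> C,
  [/\ forall u, \det (1%:M - u *: A) = \prod_i (1 - u * lam i),
      forall m, \tr (A ^+ m) = \sum_i lam i ^+ m
    & forall i, exists2 v : 'rV_n, v != 0 & v *m A = lam i *: v].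
Proof.
have [P [D [Pu Dt AE]]] := trigonalizableP A.
(* Two scalars are kept: [a = 1] gives the claim on determinants, while [b = 1] and [a = D i i] give
   a singular matrix whose kernel contains the eigenvector. *)
have detP a b : \det (a%:M - b *: A) = \prod_i (a - b * D i i).
  have -> : a%:M - b *: A = invmx P *m (a%:M - b *: D) *m P.
    rewrite AE mulmxBr mulmxBl -scalemxAr -scalemxAl mul_mx_scalar -scalemxAl.
    by rewrite mulVmx // scalemx1.
  rewrite !det_mulmx mulrC mulrA -det_mulmx mulmxV // det1 mul1r det_trig.
    by apply: eq_bigr => i _; rewrite !mxE eqxx.
  apply/is_trig_mxP => i j ij; rewrite !mxE (is_trig_mxP Dt) // mulr0 subr0.
  by rewrite -val_eqE /= ltn_eqF.
exists (fun i => D i i); split=> [u | m | i].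
- exact: detP.
- rewrite AE conjX // mxtrace_mulC mulmxA mulmxV // mul1mx /mxtrace.
  by apply: eq_bigr => i _; rewrite (trigX m Dt).2.
have /det0P [v v0 vA] : \det ((D i i)%:M - A) == 0.
  by rewrite -[A]scale1r detP prodf_seq_eq0; apply/hasP; exists i;
     rewrite ?mem_index_enum // mul1r subrr eqxx.
by exists v => //; apply/eqP; rewrite eq_sym -subr_eq0 -mul_mx_scalar -mulmxBr vA.
Qed.

(** Compare l1 norms: each of the [n] coordinates of [v *m A] is at most the l1 norm of [v]. *)
Lemma eigenvalue_bound n (A : 'M[C]_n) (v : 'rV_n) lam :
  (forall i j, `|A i j| <= 1) -> v != 0 -> v *m A = lam *: v -> `|lam| <= n%:R.
Proof.
move=> Ab v0 vA.
have S0 : 0 < \sum_j `|v 0 j|.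
  rewrite lt_def sumr_ge0 // andbT.
  apply: contra v0; rewrite psumr_eq0 // => /allP h.
  apply/eqP/rowP => j; rewrite mxE; apply/eqP; rewrite -normr_eq0.
  exact: h (mem_index_enum j).
rewrite -(ler_pM2r S0) mulr_sumr.
rewrite (eq_bigr (fun j => `|\sum_k v 0 k * A k j|)); last first.
  by move=> j _; have /rowP/(_ j) := vA; rewrite !mxE -normrM => ->.
apply: (@le_trans _ _ (\sum_(j < n) \sum_k `|v 0 k|)).
  apply: ler_sum => j _; apply: (le_trans (ler_norm_sum _ _ _)).
  by apply: ler_sum => k _; rewrite normrM ler_piMr.
by rewrite sumr_const card_ord mulr_natl.
Qed.

(** Sylvester's identity: the block matrix with unit diagonal and off-diagonal blocks [A] and [B]
    has two block triangular factorizations. It carries Bass' identity from edges to vertices. *)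
Lemma det_1subM m n (A : 'M[C]_(m, n)) (B : 'M[C]_(n, m)) :
  \det (1%:M - A *m B) = \det (1%:M - B *m A).
Proof.
have e1 : block_mx 1%:M A B 1%:M =
    block_mx 1%:M 0 B 1%:M *m block_mx 1%:M A 0 (1%:M - B *m A) :> 'M_(m + n).
  rewrite mulmx_block !(mulmx1, mul1mx, mulmx0, mul0mx, addr0, add0r).
  by rewrite [B *m A + _]addrC subrK.
have e2 : block_mx 1%:M A B 1%:M =
    block_mx (1%:M - A *m B) A 0 1%:M *m block_mx 1%:M 0 B 1%:M :> 'M_(m + n).
  rewrite mulmx_block !(mulmx1, mul1mx, mulmx0, mul0mx, addr0, add0r).
  by rewrite subrK.
have := congr1 determinant e1; rewrite {1}e2 !det_mulmx !det_lblock !det_ublock.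
by rewrite !det1 !mul1r !mulr1.
Qed.

End Spectrum.

(** * Logarithmic derivatives modulo a power of the variable *)

Section LogDerivative.
Variable C : numFieldType.
Implicit Types (f g S : {poly C}) (M : nat).

(* [S] is minus the logarithmic derivative ['X * f' / f], modulo ['X^M]. *)
Definition has_logder M f S := 'X^M %| ('X * f^`() + f * S).

Lemma has_logder1 M : has_logder M 1 0.
Proof. by rewrite /has_logder derivC !mulr0 addr0 dvdp0. Qed.

Lemma has_logderM M f g S S' :
  has_logder M f S -> has_logder M g S' -> has_logder M (f * g) (S + S').
Proof.
rewrite /has_logder => hf hg.
have -> : 'X * (f * g)^`() + f * g * (S + S') =
   g * ('X * f^`() + f * S) + f * ('X * g^`() + g * S').
  by rewrite derivM; ring.
by rewrite dvdp_add // dvdp_mull.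
Qed.

Lemma has_logder_prod M (I : Type) (r : seq I) (P : pred I)
    (F S : I -> {poly C}) : (forall i, P i -> has_logder M (F i) (S i)) ->
  has_logder M (\prod_(i <- r | P i) F i) (\sum_(i <- r | P i) S i).
Proof.
move=> h; elim/big_rec2: _ => [|i S' F' Pi hF]; first exact: has_logder1.
by apply: has_logderM => //; apply: h.
Qed.

Lemma has_logderX M f S k : has_logder M f S -> has_logder M (f ^+ k) (S *+ k).
Proof.
move=> h; elim: k => [|k IH]; first by rewrite expr0 mulr0n; apply: has_logder1.
by rewrite exprS mulrS; apply: has_logderM.
Qed.

(** With [y = lam X^d] this is the geometric series of [d y / (1 - y)] cut after [M] terms; the
    remainder [d y^(M+1)] is divisible by [X^M] because [d > 0]. *)
Lemma has_logder_1subXn M (lam : C) d : (0 < d)%N ->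
  has_logder M (1 - lam *: 'X^d)
    (\sum_(j < M) (d%:R * lam ^+ j.+1) *: 'X^(d * j.+1)).
Proof.
move=> d0; pose y : {poly C} := lam *: 'X^d.
have SE : \sum_(j < M) (d%:R * lam ^+ j.+1) *: 'X^(d * j.+1) =
     (\sum_(j < M) y ^+ j) * y *+ d.
  rewrite mulr_suml -sumrMnl; apply: eq_bigr => j _.
  by rewrite -exprSr /y exprZn -exprM mulr_natl scalerMnl.
rewrite /has_logder SE derivB derivC derivZ derivXn sub0r mulrN.
have -> : 'X * (lam *: ('X^(d.-1) *+ d)) = y *+ d.
  by rewrite -scalerAr mulrnAr -exprS prednK // -scalerMnr.
have -> : (1 - lam *: 'X^d) * ((\sum_(j < M) y ^+ j) * y *+ d) =
          y *+ d - (y ^+ M * y) *+ d.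
  have -> : y *+ d - (y ^+ M * y) *+ d = - (y ^+ M - 1) * (y *+ d) by ring.
  by rewrite subrX1 -/y; ring.
rewrite addrA addNr add0r dvdpNr -mulrnAr dvdp_mulr //.
by rewrite /y exprZn -exprM -mul_polyC dvdp_mull // dvdp_exp2l // leq_pmull.
Qed.

Lemma dvdp_Xn_coef M f : reflect (forall k, (k < M)%N -> f`_k = 0) ('X^M %| f).
Proof.
apply: (iffP idP) => [/dvdpP [q ->] k kM|h]; first by rewrite coefMXn kM.
rewrite -(poly_take_drop M f) dvdp_add ?dvdp_mulIr //.
suff -> : take_poly M f = 0 by apply: dvdp0.
by apply/polyP => k; rewrite coef_take_poly coef0; case: ltnP => // /h.
Qed.

(** The difference [h = f - g] satisfies [X h' + h S = 0] modulo [X^M]. As [S] has no constant term,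
    coefficient [k] reads [k h_k] plus a combination of earlier [h_i], and characteristic zero lets
    [k] be cancelled. *)
Lemma has_logder_inj M f g S S' : f`_0 = 1 -> g`_0 = 1 ->
  S`_0 = 0 -> (forall k, (k < M)%N -> S`_k = S'`_k) ->
  has_logder M f S -> has_logder M g S' -> 'X^M %| f - g.
Proof.
move=> f0 g0 S0 SS' hf hg.
have SS'd : 'X^M %| S - S'.
  by apply/dvdp_Xn_coef => k kM; rewrite coefB SS' // subrr.
have : 'X^M %| 'X * (f - g)^`() + (f - g) * S.
  have -> : 'X * (f - g)^`() + (f - g) * S =
    ('X * f^`() + f * S) - ('X * g^`() + g * S') - g * (S - S').
    by rewrite derivB; ring.
  by rewrite !dvdp_sub // dvdp_mull.
move=> /dvdp_Xn_coef h; apply/dvdp_Xn_coef.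
elim/ltn_ind => -[|k] IH kM; first by rewrite coefB f0 g0 subrr.
have := h _ kM; rewrite [LHS]coefD coefXM /= coef_deriv coefM big_ord_recr /=.
rewrite subnn S0 mulr0 addr0 big1 ?addr0 => [/eqP|[i ik] _ /=].
  by rewrite mulrn_eq0 /= => /eqP.
by rewrite IH ?mul0r // (ltn_trans ik).
Qed.

End LogDerivative.

(** * A submultiplicative norm on polynomials *)

Section WeightedNorm.
Variable C : numFieldType.
Implicit Types (p q : {poly C}) (rho u : C).

Definition wnorm rho p := \sum_(i < size p) `|p`_i| * rho ^+ i.

Lemma wnormE rho p n : (size p <= n)%N -> wnorm rho p = \sum_(i < n) `|p`_i| * rho ^+ i.
Proof.
move=> pn; rewrite /wnorm -!(big_mkord xpredT (fun i => `|p`_i| * rho ^+ i)).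
rewrite [RHS](big_cat_nat _ pn) //= [X in _ + X]big_nat [X in _ + X]big1 ?addr0 // => i /andP[h _].
by rewrite nth_default // normr0 mul0r.
Qed.

Lemma wnorm_ge0 rho p : 0 <= rho -> 0 <= wnorm rho p.
Proof. by move=> r0; apply: sumr_ge0 => i _; rewrite mulr_ge0 ?exprn_ge0. Qed.

Lemma wnormC rho (c : C) : wnorm rho c%:P = `|c|.
Proof.
by rewrite (wnormE _ (size_polyC_leq1 c)) big_ord1 coefC eqxx expr0 mulr1.
Qed.

Lemma wnormB rho p q : 0 <= rho -> wnorm rho (p - q) <= wnorm rho p + wnorm rho q.
Proof.
move=> r0; pose n := maxn (size p) (size q).
rewrite (@wnormE rho (p - q) n); last first.
  by rewrite (leq_trans (size_polyD _ _)) // size_polyN.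
rewrite (@wnormE rho p n) ?leq_maxl // (@wnormE rho q n) ?leq_maxr //.
rewrite -big_split /=; apply: ler_sum => i _.
by rewrite -mulrDl ler_wpM2r ?exprn_ge0 // coefB ler_normB.
Qed.

Lemma wnormM rho p q : 0 <= rho -> wnorm rho (p * q) <= wnorm rho p * wnorm rho q.
Proof.
move=> r0; pose n := (size p + size q)%N.
rewrite (@wnormE rho (p * q) n); last first.
  by rewrite (leq_trans (size_polyMleq _ _)) // leq_pred.
apply: (@le_trans _ _ (\sum_(k < n) \sum_(i < n | (i <= k)%N)
   (`|p`_i| * rho ^+ i) * (`|q`_(k - i)| * rho ^+ (k - i)))).
  apply: ler_sum => k _; rewrite coefM.
  rewrite (big_ord_widen n (fun i : nat => p`_i * q`_(k - i))) //.
  apply: (le_trans (ler_wpM2r (exprn_ge0 _ r0) (ler_norm_sum _ _ _))).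
  rewrite mulr_suml; apply: ler_sum => i; rewrite ltnS => ik.
  have -> : rho ^+ k = rho ^+ i * rho ^+ (k - i) by rewrite -exprD subnKC.
  by rewrite normrM mulrACA.
rewrite (exchange_big_dep xpredT) //=.
rewrite [X in _ <= X * _](@wnormE rho p n) ?leq_addr // mulr_suml.
apply: ler_sum => i _; rewrite -mulr_sumr ler_wpM2l ?mulr_ge0 ?exprn_ge0 //.
rewrite (@wnormE rho q n) ?leq_addl //.
rewrite -(big_mkord (fun k => (i <= k)%N) (fun k => `|q`_(k - i)| * rho ^+ (k - i))).
rewrite (big_cat_nat _ (ltnW (ltn_ord i))) //= big_nat_cond big1 ?add0r; last first.
  by move=> k /andP[/andP[_ ki]]; rewrite leqNgt ki.
rewrite -{1}[nat_of_ord i]add0n big_addn.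
under eq_bigl do rewrite leq_addl.
under eq_bigr do rewrite addnK.
rewrite -(big_mkord xpredT (fun i => `|q`_i| * rho ^+ i)).
rewrite [X in _ <= X](big_cat_nat _ (leq_subr i n)) //= ler_wpDr //.
by apply: sumr_ge0 => k _; rewrite mulr_ge0 ?exprn_ge0.
Qed.

Lemma wnorm_prod rho (I : Type) (r : seq I) (F : I -> {poly C}) : 0 <= rho ->
  wnorm rho (\prod_(i <- r) F i) <= \prod_(i <- r) wnorm rho (F i).
Proof.
move=> r0; elim/big_rec2: _ => [|i y x _ h]; first by rewrite wnormC normr1.
by apply: (le_trans (wnormM _ _ r0)); rewrite ler_wpM2l ?wnorm_ge0.
Qed.

Lemma wnorm_monomial rho (c : C) k : wnorm rho (c *: 'X^k) = `|c| * rho ^+ k.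
Proof.
rewrite (@wnormE _ _ k.+1) ?(leq_trans (size_scale_leq _ _)) ?size_polyXn //.
rewrite big_ord_recr /= big1 ?add0r => [|[i ik] _] /=.
  by rewrite coefZ coefXn eqxx mulr1.
by rewrite coefZ coefXn ltn_eqF // mulr0 normr0 mul0r.
Qed.

(** A Schwarz lemma read off the coefficients: only degrees [i >= M] occur, and there
    [|u|^i <= (|u|/rho)^M rho^i]. *)
Lemma norm_horner_le rho p u M : 0 < rho -> `|u| <= rho -> 'X^M %| p ->
  `|p.[u]| <= (`|u| / rho) ^+ M * wnorm rho p.
Proof.
move=> r0 ur /dvdp_Xn_coef h.
rewrite horner_coef /wnorm; apply: (le_trans (ler_norm_sum _ _ _)).
rewrite mulr_sumr; apply: ler_sum => i _.
have [iM|Mi] := ltnP i M; first by rewrite h // mul0r normr0 mul0r mulr0.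
rewrite normrM normrX mulrCA ler_wpM2l //.
have E (x : C) : x ^+ i = x ^+ M * x ^+ (i - M) by rewrite -exprD subnKC.
rewrite !E mulrA -exprMn divfK ?gt_eqF // ler_wpM2l ?exprn_ge0 //.
by apply: lerXn2r => //; rewrite nnegrE ?ltW.
Qed.

End WeightedNorm.

(** * Bass' identity *)

Definition nonback (V E : choiceType) (Y : graph V E) (f g : E) :=
  (term Y f == org Y g) && (g != einv Y f).

Lemma term_einv (V E : choiceType) (Y : graph V E) f :
  term Y (einv Y f) = org Y f.
Proof. by rewrite /term (einvK Y). Qed.

Section Bass.
Variables (C : numClosedFieldType) (VX EX : finType) (X : graph VX EX).
Variable x : EX -> C.
Hypothesis xV : forall f, x f * x (einv X f) = 1.

(** Hashimoto's non-backtracking matrix. The weight sits on the edge that is entered, so that a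
    power collects the weight of every edge but the first. *)
Definition edge_mx : 'M[C]_#|EX| :=
  \matrix_(i, j) ((nonback X (enum_val i) (enum_val j))%:R * x (enum_val j)).

Definition weighted_adjacency (v w : VX) : C :=
  \sum_(f | (org X f == v) && (term X f == w)) x f.

Definition weighted_Delta (u : C) : 'M[C]_#|VX| :=
  1%:M - u *: (\matrix_(i, j) weighted_adjacency (enum_val i) (enum_val j))
  + u ^+ 2 *: diag_mx (\row_i ((degree X (enum_val i))%:R - 1)).

(** [Tm *m Sm] joins consecutive edges, backtracks included, and [J] takes the backtracks away. In
    the other order, [Sm *m Tm] is the weighted adjacency matrix and [Sm *m J *m Tm] the degree
    matrix. *)
Let Sm : 'M[C]_(#|VX|, #|EX|) :=
  \matrix_(i, j) ((org X (enum_val j) == enum_val i)%:R * x (enum_val j)).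
Let Tm : 'M[C]_(#|EX|, #|VX|) :=
  \matrix_(i, j) (term X (enum_val i) == enum_val j)%:R.
Let J : 'M[C]_#|EX| :=
  \matrix_(i, j) ((enum_val j == einv X (enum_val i))%:R * x (enum_val j)).

Lemma sum_enum_val (T : finType) (F : T -> C) :
  \sum_(i < #|T|) F (enum_val i) = \sum_a F a.
Proof. by rewrite (reindex _ (onW_bij _ (enum_val_bij T))). Qed.

Lemma sum_pointed (T : finType) (a : T) (F : T -> C) :
  \sum_b (b == a)%:R * F b = F a.
Proof.
rewrite (bigD1 a) //= eqxx mul1r big1 ?addr0 // => b /negPf ->.
by rewrite mul0r.
Qed.

Lemma enum_val_eq (T : finType) (i j : 'I_#|T|) : (enum_val i == enum_val j) = (i == j).
Proof. exact/inj_eq/enum_val_inj. Qed.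

Let edge_mxE : edge_mx = Tm *m Sm - J.
Proof.
apply/matrixP => i j; rewrite !mxE.
rewrite (eq_bigr (fun k : 'I_#|VX| => (enum_val k == org X (enum_val j))%:R *
   ((term X (enum_val i) == enum_val k)%:R * x (enum_val j)))); last first.
  by move=> k _; rewrite !mxE [org X _ == _]eq_sym mulrCA.
rewrite (sum_enum_val (fun v => (v == org X (enum_val j))%:R *
   ((term X (enum_val i) == v)%:R * x (enum_val j)))) sum_pointed -mulrBl.
congr (_ * _); rewrite /nonback.
have [->|] := eqVneq (enum_val j) (einv X (enum_val i)).
  by rewrite andbF /term eqxx subrr.
by rewrite andbT subr0.
Qed.

Let JJ : J *m J = 1%:M.
Proof.
apply/matrixP => i j; rewrite !mxE.
rewrite (eq_bigr (fun k : 'I_#|EX| => (enum_val k == einv X (enum_val i))%:R *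
  (x (enum_val k) * ((enum_val j == einv X (enum_val k))%:R * x (enum_val j))))); last first.
  by move=> k _; rewrite !mxE -mulrA.
rewrite (sum_enum_val (fun g => (g == einv X (enum_val i))%:R *
  (x g * ((enum_val j == einv X g)%:R * x (enum_val j))))) sum_pointed (einvK X).
rewrite enum_val_eq eq_sym; case: eqVneq => [->|_]; last by rewrite mul0r mulr0.
by rewrite mul1r mulrC xV.
Qed.

Let SJT : Sm *m J *m Tm = diag_mx (\row_i (degree X (enum_val i))%:R).
Proof.
apply/matrixP => i j; rewrite !mxE.
pose F f g := (org X f == enum_val i)%:R * x f * ((g == einv X f)%:R * x g) *
                (term X g == enum_val j)%:R.
rewrite (eq_bigr (fun k : 'I_#|EX| => \sum_f F f (enum_val k))); last first.
  move=> k _; rewrite !mxE mulr_suml -[RHS]sum_enum_val.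
  by apply: eq_bigr => l _; rewrite !mxE.
rewrite (sum_enum_val (fun g => \sum_f F f g)) exchange_big /=.
rewrite (eq_bigr (fun f => (org X f == enum_val i)%:R * (i == j)%:R)); last first.
  move=> f _; rewrite (eq_bigr (fun g => (g == einv X f)%:R *
    ((org X f == enum_val i)%:R * x f * x g * (term X g == enum_val j)%:R))); last first.
    by move=> g _; rewrite /F; ring.
  rewrite sum_pointed -mulrA -mulrA [x _ * (_ * _)]mulrA xV mul1r.
  rewrite term_einv; case: eqVneq => [->|_]; rewrite ?mul0r ?mul1r //.
  by rewrite enum_val_eq.
rewrite -mulr_suml mulr_natr; congr (_ *+ _).
rewrite -natr_sum /degree -sum1dep_card; congr (_%:R).
by rewrite [RHS]big_mkcond; apply: eq_bigr => f _; case: (_ == _).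
Qed.

Let ST : Sm *m Tm = \matrix_(i, j) weighted_adjacency (enum_val i) (enum_val j).
Proof.
apply/matrixP => i j; rewrite !mxE.
rewrite (eq_bigr (fun k : 'I_#|EX| => (org X (enum_val k) == enum_val i)%:R *
   x (enum_val k) * (term X (enum_val k) == enum_val j)%:R)); last first.
  by move=> k _; rewrite !mxE.
rewrite (sum_enum_val (fun f => (org X f == enum_val i)%:R * x f *
   (term X f == enum_val j)%:R)) /weighted_adjacency [RHS]big_mkcond /=.
apply: eq_bigr => f _; do 2 case: eqP => _ //=; rewrite ?mul0r ?mulr0 ?mul1r ?mulr1 //.
Qed.

(** [J] is an involution, of trace zero because no edge is its own reverse. So its eigenvalues [1]
    and [-1] are equally frequent, and no orientation of the edges has to be chosen. *)
Lemma det_1addJ u : \det (1%:M + u *: J) = (1 - u ^+ 2) ^+ #|EX|./2.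
Proof.
have [lam [hdet htr hev]] := spectrum J.
have lam1 i : (lam i == 1) || (lam i == -1).
  have [v v0 vJ] := hev i; rewrite -sqrf_eq1.
  have : v *m (J *m J) = lam i ^+ 2 *: v by rewrite mulmxA vJ -scalemxAl vJ scalerA.
  rewrite JJ mulmx1 => /eqP; rewrite -subr_eq0 -[X in X - _]scale1r -scalerBl.
  by rewrite scaler_eq0 (negPf v0) orbF subr_eq0 eq_sym.
pose a := #|[pred i | lam i == 1]|; pose b := #|[pred i | lam i != 1]|.
have ab : (a + b = #|EX|)%N by rewrite -[RHS]card_ord -(cardC [pred i | lam i == 1]).
have lamN i : lam i != 1 -> lam i = -1 by move=> /negPf h; move: (lam1 i); rewrite h => /eqP.
have : a%:R = b%:R :> C.
  have := htr 1%N; rewrite expr1 /mxtrace big1 => [|i _]; last first.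
    by rewrite !mxE eq_sym (negPf (einv_neq X _)) mul0r.
  under eq_bigr do rewrite expr1.
  rewrite (bigID (fun i => lam i == 1)) /= (eq_bigr (fun=> 1)) => [|i /eqP //].
  rewrite [X in _ + X](eq_bigr (fun=> -1)) => [|i /lamN //].
  by rewrite !sumr_const mulNrn => /esym/eqP; rewrite subr_eq0 => /eqP.
move=> /eqP; rewrite eqr_nat => /eqP eab.
have -> : 1%:M + u *: J = 1%:M - (- u) *: J by rewrite scaleNr opprK.
rewrite hdet (bigID (fun i => lam i == 1)) /=.
rewrite (eq_bigr (fun=> 1 + u)) => [|i /eqP ->]; last by ring.
rewrite [X in _ * X](eq_bigr (fun=> 1 - u)) => [|i /lamN ->]; last by ring.
rewrite !prodr_const -/a -/b -eab -exprMn -ab -eab addnn doubleK.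
by congr (_ ^+ _); ring.
Qed.

(** Factor out [1 + u J], whose inverse is [K] since [J] is an involution, and apply Sylvester's
    identity to the other factor. The vertex matrix is then [q^-1] times
    [q - u (Sm Tm) + u^2 (Sm J Tm)], where [q = 1 - u^2] supplies the [-1] of [degree - 1]. *)
Theorem bass_identity u : 1 - u ^+ 2 != 0 ->
  \det (1%:M - u *: edge_mx) * (1 - u ^+ 2) ^+ #|VX| =
  (1 - u ^+ 2) ^+ #|EX|./2 * \det (weighted_Delta u).
Proof.
move=> u2; set q := 1 - u ^+ 2.
pose K := q^-1 *: (1%:M - u *: J).
have JK : (1%:M + u *: J) *m K = 1%:M.
  rewrite -scalemxAr mulmxDl !mulmxBr !mulmx1 !mul1mx -!scalemxAl -!scalemxAr JJ.
  rewrite addrA subrK scalerA -expr2 -[X in X - _]scale1r -scalerBl -/q scalerA.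
  by rewrite mulVf // scale1r.
have -> : 1%:M - u *: edge_mx = (1%:M + u *: J) *m (1%:M - (u *: (K *m Tm)) *m Sm).
  rewrite mulmxBr mulmx1 -scalemxAl -scalemxAr !mulmxA JK mul1mx edge_mxE.
  by rewrite scalerBr opprB addrA addrAC.
rewrite det_mulmx det_1addJ det_1subM -mulrA; congr (_ * _).
have -> : 1%:M - Sm *m (u *: (K *m Tm)) = q^-1 *: weighted_Delta u.
  rewrite -scalemxAr mulmxA /K -scalemxAr mulmxBr mulmx1 -scalemxAr -scalemxAl mulmxBl.
  rewrite -scalemxAl SJT ST /weighted_Delta -[1%:M in LHS](scalerK u2) -/q.
  rewrite scalerA [u * _]mulrC -scalerA -scalerBr; congr (_ *: _).
  apply/matrixP => i j; rewrite !mxE; case: eqP => _ /=; rewrite /q ?mulr1n ?mulr0n; ring.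
rewrite detZ exprVn mulrAC mulVf ?mul1r //.
by rewrite expf_neq0.
Qed.

End Bass.

(** * Free reduction and primitive words *)

Section FreeReduction.
Variables (E : eqType) (inv : E -> E).
Hypotheses (invK : involutive inv) (inv_neq : forall e, inv e != e).
Implicit Types (s t w : seq E) (e f : E).

Definition nobt e f := f != inv e.

Definition push e s :=
  if s is f :: s' then (if f == inv e then s' else e :: s) else [:: e].
Definition red s := foldr push [::] s.
Definition reduced s := sorted nobt s.

Lemma push_reduced e s : reduced s -> reduced (push e s).
Proof.
case: s => //= f s; case: eqP => [_|/eqP fe]; first exact: path_sorted.
by rewrite /= /nobt fe.
Qed.

Lemma red_reduced s : reduced (red s).
Proof. by elim: s => //= e s IH; apply: push_reduced. Qed.

(** Van der Waerden's trick: each letter acts on the reduced words and the inverse letter undoes it.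
    Invariance of [red] under backtracks follows without a confluence argument. *)
Lemma pushK e s : reduced s -> push e (push (inv e) s) = s.
Proof.
case: s => [|f s] /=; first by rewrite eqxx.
rewrite invK; case: eqVneq => [->|fe] /= hs; last by rewrite eqxx.
by case: s hs => //= g s /andP[/negPf ->].
Qed.

Lemma red_id s : reduced s -> red s = s.
Proof.
elim: s => //= e s IH hs; rewrite IH; last exact: path_sorted hs.
by case: s hs {IH} => //= g s /andP[/negPf ->].
Qed.

Lemma red_cat s t : red (s ++ t) = foldr push (red t) s.
Proof. exact: foldr_cat. Qed.

Lemma red_catr s t : red (s ++ red t) = red (s ++ t).
Proof. by rewrite !red_cat red_id // red_reduced. Qed.

Lemma red_backtrack s e t : red (s ++ e :: inv e :: t) = red (s ++ t).
Proof. by rewrite !red_cat /= pushK // red_reduced. Qed.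

Lemma red_catl s t : red (red s ++ t) = red (s ++ t).
Proof.
elim: s => //= e s <-; case: (red s) => [//|f r] /=.
by case: eqVneq => [->|_] //=; rewrite pushK // red_reduced.
Qed.

Definition chop s := behead (take (size s).-1 s).
Arguments chop : simpl never.
(** [n] is fuel, and [size s] is enough because [chop] drops both ends. On a reduced word the test
    fails only if the two ends cancel, so [core] is then the cyclic reduction. *)
Fixpoint strip n s :=
  if n is n'.+1 then (if cycle nobt s then s else strip n' (chop s)) else s.
Definition core s := strip (size s) s.

Lemma size_chop s : size (chop s) = (size s).-2.
Proof. by rewrite size_behead size_take; case: s => //= e s; rewrite leqnn. Qed.

Lemma strip_fuel n s : (size s <= n)%N -> strip n s = core s.
Proof.
have [k] := ubnP (size s); elim: k n s => // k IH n s sk sn; rewrite /core.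
case: s => [|e s] in sk sn *; first by case: n sn.
case: n sn => // n sn /=; case: ifP => // _.
have hc : (size (chop (e :: s)) <= size s)%N by rewrite size_chop leq_pred.
by rewrite !IH // ?(leq_ltn_trans hc) // (leq_trans hc).
Qed.

Lemma core_cycle s : cycle nobt s -> core s = s.
Proof. by rewrite /core; case: s => // e s /= ->. Qed.

Lemma core_conj e s : core (e :: rcons s (inv e)) = core s.
Proof.
rewrite /core /= -[X in if X then _ else _]/(cycle nobt (e :: rcons s (inv e))).
have -> : cycle nobt (e :: rcons s (inv e)) = false.
  by rewrite /= rcons_path last_rcons /nobt invK eqxx andbF.
have -> : chop (e :: rcons s (inv e)) = s.
  by rewrite /chop /= size_rcons /= -cats1 take_size_cat.
by rewrite strip_fuel // size_rcons.
Qed.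

Lemma reduced_cases s : reduced s ->
  cycle nobt s \/ exists e t, s = e :: rcons t (inv e).
Proof.
case: s => [|e s]; first by left.
case/lastP: s => [|s f] hs; first by left; rewrite /= andbT /nobt eq_sym.
have [fe|ne] := eqVneq f (inv e); first by right; exists e, s; rewrite fe.
left; rewrite /= rcons_path last_rcons; apply/andP; split=> //.
by rewrite /nobt -(inj_eq (can_inj invK)) invK eq_sym.
Qed.

Lemma reduced_rcons s e : reduced (rcons s e) -> reduced s.
Proof. by rewrite /reduced; case: s => //= f s; rewrite rcons_path => /andP[]. Qed.

Lemma size_core s : (size (core s) <= size s)%N.
Proof.
rewrite /core; move: {1}(size s) => n; elim: n s => //= n IH s.
case: ifP => // _; apply: leq_trans (IH _) _; rewrite size_chop.
by rewrite -!subn1 -subnDA leq_subr.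
Qed.

Lemma size_push e s : (size (push e s) <= (size s).+1)%N.
Proof. by case: s => //= f s; case: ifP => //= _; rewrite ltnW. Qed.

Lemma size_red s : (size (red s) <= size s)%N.
Proof. by elim: s => //= e s IH; apply: leq_trans (size_push _ _) _. Qed.

Lemma reduced_cycle s : cycle nobt s -> reduced s.
Proof. by case: s => //= e s; rewrite rcons_path => /andP[]. Qed.

Definition roteq s t := exists i, t = rot i s.

Lemma roteq_refl s : roteq s s.
Proof. by exists 0; rewrite rot0. Qed.

Lemma roteq_rot i s : roteq s (rot i s). Proof. by exists i. Qed.

Lemma rot_bounded i s : exists2 j, (j <= size s)%N & rot i s = rot j s.
Proof.
have [h|h] := leqP i (size s); first by exists i.
by exists 0; rewrite // rot0 rot_oversize // ltnW.
Qed.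

Lemma roteq_sym s t : roteq s t -> roteq t s.
Proof.
move=> [i ->]; have [j js ->] := rot_bounded i s.
by exists (size (rot j s) - j)%N; rewrite -/(rotr j (rot j s)) rotK.
Qed.

Lemma roteq_trans s t w : roteq s t -> roteq t w -> roteq s w.
Proof.
move=> [i ->] [j ->]; have [i' is' ->] := rot_bounded i s.
have [j'] := rot_bounded j (rot i' s); rewrite size_rot => js' ->.
by rewrite rot_add_mod //; eexists.
Qed.

Lemma roteq_size s t : roteq s t -> size s = size t.
Proof. by move=> [i ->]; rewrite size_rot. Qed.

(** The cases are which ends of [e s e^-1] cancel. If none or both do, the cores agree; if exactly
    one does, both words are already cyclically reduced and differ by a rotation. *)
Lemma core_red_conj e s : reduced s ->
  roteq (core s) (core (red (e :: rcons s (inv e)))).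
Proof.
case/lastP: s => [|x f] hs; first by rewrite /= eqxx; apply: roteq_refl.
have [fe|fe] := eqVneq f e.
  rewrite {f}fe in hs *.
  have -> : red (e :: rcons (rcons x e) (inv e)) = push e x.
    rewrite /= -cats1 -cats1 -catA red_backtrack cats0 red_id //.
    exact: reduced_rcons hs.
  case: x hs => [|g x] hs /=; first exact: roteq_refl.
  case: eqVneq => [ge|ge].
    by rewrite ge -[X in rcons x X]invK core_conj; apply: roteq_refl.
  have rE : rcons (g :: x) e = rot 1 (e :: g :: x) by rewrite rot1_cons.
  have cy : cycle nobt (e :: g :: x) by rewrite /= /nobt ge; apply: hs.
  rewrite -rcons_cons rE !core_cycle ?rot_cycle //.
  exact/roteq_sym/roteq_rot.
have hr : reduced (rcons (rcons x f) (inv e)).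
  case: x hs => [|g x] /=; first by rewrite andbT /nobt (inj_eq (can_inj invK)) eq_sym.
  move=> hs; rewrite rcons_path /reduced /= hs last_rcons /nobt.
  by rewrite (inj_eq (can_inj invK)) eq_sym.
rewrite [red _]/= (red_id hr).
case: x hs hr => [|g x] hs hr /=.
  case: eqVneq => [->|_]; first exact: roteq_refl.
  rewrite -[[:: e; f; inv e]]/(e :: rcons [:: f] (inv e)) core_conj.
  exact: roteq_refl.
case: eqVneq => [ge|ge].
  have cy : cycle nobt (g :: rcons x f) by rewrite /= ge; rewrite ge in hr.
  rewrite -ge -[rcons (rcons x f) g]rot1_cons !core_cycle ?rot_cycle //; exact: roteq_rot.
rewrite -[g :: rcons (rcons x f) _]/(rcons (g :: rcons x f) (inv e)) core_conj.
exact: roteq_refl.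
Qed.

Definition nf s := core (red s).

Lemma nf_cycle s : cycle nobt s -> nf s = s.
Proof. by move=> h; rewrite /nf red_id ?core_cycle //; apply: reduced_cycle. Qed.

Lemma size_nf s : (size (nf s) <= size s)%N.
Proof. exact: leq_trans (size_core _) (size_red _). Qed.

Lemma nf_backtrack s e t : nf (s ++ e :: inv e :: t) = nf (s ++ t).
Proof. by rewrite /nf red_backtrack. Qed.

(** Freely, [e :: s] is the conjugate of [rcons s e] by [e]. *)
Lemma nf_rotate e s : roteq (nf (rcons s e)) (nf (e :: s)).
Proof.
have := core_red_conj e (red_reduced (rcons s e)).
have -> : red (e :: rcons (red (rcons s e)) (inv e)) = red (e :: s) => //.
rewrite /= -cats1 red_catl -cats1 -catA red_backtrack cats0 //.
Qed.

Definition pow s k : seq E := flatten (nseq k s).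

Lemma powS s k : pow s k.+1 = s ++ pow s k. Proof. by []. Qed.

Lemma size_pow s k : size (pow s k) = (k * size s)%N.
Proof. by elim: k => // k IH; rewrite powS size_cat IH mulSn. Qed.

Lemma cycle_pow (r : rel E) s k : cycle r s -> cycle r (pow s k).
Proof.
case: s => [|e s]; first by elim: k.
set x := last e s; have xE t : last x (e :: s) = x by [].
rewrite (cycle_path x) => hs.
have h j : path r x (pow (e :: s) j) /\ last x (pow (e :: s) j) = x.
  elim: j => //= j [IH1 IH2]; rewrite cat_path last_cat -/x; split=> //.
  by move: hs => /=/andP[-> ->]; rewrite -/x.
by rewrite (cycle_path x) (h k).2 (h k).1.
Qed.

Lemma pow_rotate e s k : pow (e :: s) k ++ [:: e] = e :: pow (rcons s e) k.
Proof. by elim: k => //= k IH; rewrite !powS -catA IH cat_rcons. Qed.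

Lemma nf_pow_rotate e s k : roteq (nf (pow (rcons s e) k)) (nf (pow (e :: s) k)).
Proof.
case: k => [|k]; first exact: roteq_refl.
have := pow_rotate e s k.+1; rewrite powS /= cats1 => -[h].
rewrite -h; exact: nf_rotate.
Qed.

Lemma red_pow_backtrack s e t k :
  red (pow (s ++ e :: inv e :: t) k) = red (pow (s ++ t) k).
Proof.
elim: k => // k IH; rewrite !powS -catA /= red_backtrack catA.
by rewrite -red_catr IH red_catr.
Qed.

Lemma not_reduced s : ~~ reduced s -> exists a e b, s = a ++ e :: inv e :: b.
Proof.
elim: s => //= e [|f s] IH //=; rewrite negb_and negbK => /orP[/eqP ->|/IH].
  by exists [::], e, s.
by move=> [a [g [b ->]]]; exists (e :: a), g, b.
Qed.

(** This brings a homotopy to a [k]-th power down to an equality of words, as primitivity requires.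
    A backtrack in [s] disappears from every power, and a conjugating end letter is rotated into a
    backtrack, so one [w] serves all [k]. *)
Lemma nf_pow s : exists2 w, cycle nobt w & forall k, roteq (nf (pow s k)) (pow w k).
Proof.
have [n] := ubnP (size s); elim: n s => // n IH s sn.
have [hs|/not_reduced [a [e [b sE]]]] := boolP (reduced s); last first.
  have [|w hw hk] := IH (a ++ b).
    by move: sn; rewrite sE !size_cat /= !addnS => /ltnW.
  by exists w => // k; rewrite sE /nf red_pow_backtrack; apply: hk.
have [cs|[e [t st]]] := reduced_cases hs.
  by exists s => // k; rewrite nf_cycle ?cycle_pow //; apply: roteq_refl.
have [|w hw hk] := IH t.
  by move: sn; rewrite st /= size_rcons ltnS => /ltnW.
exists w => // k; apply: roteq_trans (hk k); rewrite st.
apply: roteq_trans (roteq_sym (nf_pow_rotate e (rcons t (inv e)) k)) _.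
rewrite -cats1 -cats1 -catA /= -[X in [:: _; X]]invK /nf red_pow_backtrack cats0.
exact: roteq_refl.
Qed.

End FreeReduction.

(** * Periods and primitive roots of cyclic words *)

Section Periods.
Variables (E : finType) (x0 : E).
Implicit Types (s t w z : seq E).
Local Open Scope nat_scope.

(** On the infinite periodic word the periods are closed under remainders, so the least one divides
    all others; on finite words this would need a bound on the lengths. *)
Definition cyc w i := nth x0 w (i %% size w).
Definition period (f : nat -> E) d := forall i, f (i + d) = f i.
Definition prim w := 0 < size w /\
  forall d, 0 < d -> period (cyc w) d -> size w <= d.

Lemma cyc_period w : period (cyc w) (size w).
Proof. by move=> i; rewrite /cyc modnDr. Qed.

Lemma periodM f d k : period f d -> period f (k * d).
Proof. by move=> h; elim: k => [|k IH] i; rewrite ?mul0n ?addn0 // mulSnr addnA h IH. Qed.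

Lemma period_mod f d D : period f d -> period f D -> period f (D %% d).
Proof.
move=> hd hD i; rewrite -[RHS]hD [in RHS](divn_eq D d) [_ * d + _]addnC addnA.
by rewrite periodM.
Qed.

Lemma eq_cyc w w' : size w = size w' -> cyc w =1 cyc w' -> w = w'.
Proof.
move=> hs hc; apply: (@eq_from_nth _ x0) => // i iw.
by have := hc i; rewrite /cyc !modn_small // -hs.
Qed.

Lemma cyc_nil w i : size w = 0 -> cyc w i = x0.
Proof. by move=> /size0nil ->; rewrite /cyc nth_nil. Qed.

Lemma cyc_pow w k : 0 < k -> cyc (pow w k) =1 cyc w.
Proof.
move=> k0 i; have [w0|w0] := posnP (size w).
  by rewrite !cyc_nil // size_pow w0 muln0.
rewrite /cyc size_pow -[in RHS](modn_dvdm _ (dvdn_mull k (dvdnn (size w)))).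
have : i %% (k * size w) < k * size w by rewrite ltn_mod muln_gt0 k0.
move: (i %% _) => j {i}; elim: k {k0} j => // k IH j jk.
rewrite powS nth_cat; case: ltnP => [jw|wj]; first by rewrite modn_small.
rewrite IH; last by rewrite ltn_subLR // -mulSn.
by rewrite -[in RHS](subnK wj) modnDr.
Qed.

Lemma cyc_rot w j i : j <= size w -> cyc (rot j w) i = cyc w (i + j).
Proof.
move=> jw; have [w0|w0] := posnP (size w); first by rewrite !cyc_nil // size_rot.
rewrite /cyc size_rot -modnDml; move: (ltn_pmod i w0); move: (i %% _) => {}i iw.
rewrite /rot nth_cat size_drop; case: ltnP => h.
  by rewrite nth_drop modn_small 1?addnC // -ltn_subRL.
rewrite nth_take; last by rewrite ltn_subLR // subnK.
have -> : i + j = i - (size w - j) + size w by lia.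
by rewrite modnDr modn_small //; lia.
Qed.

Lemma cyc_mkseq f d : 0 < d -> period f d -> cyc (mkseq f d) =1 f.
Proof.
move=> d0 fd i; rewrite /cyc size_mkseq nth_mkseq ?ltn_mod //.
by rewrite [in RHS](divn_eq i d) addnC periodM.
Qed.

Lemma prim_dvd w d : prim w -> period (cyc w) d -> size w %| d.
Proof.
move=> [w0 wmin] wd; rewrite /dvdn; have [//|d0] := posnP (d %% size w).
have := wmin _ d0 (period_mod (@cyc_period w) wd).
by rewrite leqNgt ltn_mod w0.
Qed.

Lemma prim_root_exists w : 0 < size w ->
  exists z k, [/\ prim z, 0 < k & w = pow z k].
Proof.
move=> w0; pose Q d := `[< 0 < d /\ period (cyc w) d >].
have exQ : exists d, Q d.
  by exists (size w); apply/asboolP; split=> //; apply: cyc_period.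
have [d /asboolP[d0 hd] dmin] := ex_minnP exQ.
pose z := mkseq (cyc w) d.
have zc : cyc z =1 cyc w by apply: cyc_mkseq.
have zp : prim z.
  split=> [|d' d'0 hd']; rewrite size_mkseq //.
  by apply: dmin; apply/asboolP; split=> // i; rewrite -!zc.
have dw : d %| size w.
  rewrite -[d](size_mkseq (cyc w)); apply: prim_dvd zp _ => i.
  by rewrite !zc cyc_period.
have k0 : 0 < size w %/ d by rewrite divn_gt0 // dvdn_leq.
exists z, (size w %/ d); split=> //; apply: eq_cyc.
  by rewrite size_pow size_mkseq divnK.
by move=> i; rewrite cyc_pow.
Qed.

Lemma prim_pow_inj z z' k k' : prim z -> prim z' -> 0 < k -> 0 < k' ->
  pow z k = pow z' k' -> z = z'.
Proof.
move=> [z0 hz] [z'0 hz'] k0 k'0 e.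
have c : cyc z =1 cyc z' by move=> i; rewrite -(cyc_pow z k0) e cyc_pow.
apply: eq_cyc => //; apply/eqP; rewrite eqn_leq hz // ?hz' // => i.
  by rewrite -!c cyc_period.
by rewrite !c cyc_period.
Qed.

Lemma prim_rot z i : prim z -> prim (rot i z).
Proof.
move=> [z0 hz]; have [j jz ->] := rot_bounded i z.
split=> [|d d0 hd]; rewrite size_rot //; apply: hz => // l.
have {}jz : j <= size z by [].
have := hd (l + size z - j); rewrite !cyc_rot //.
have -> : l + size z - j + d + j = l + d + size z by lia.
have -> : l + size z - j + j = l + size z by lia.
by rewrite !cyc_period.
Qed.

Lemma prim_rot_inj z i j : prim z -> i < size z -> j < size z ->
  rot i z = rot j z -> i = j.
Proof.
move=> zp; wlog ij : i j / i <= j => [wl iz jz e|iz jz e].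
  by have [ij|/ltnW ij] := leqP i j; [apply: wl | apply/esym/wl].
have : size z %| j - i.
  apply: prim_dvd => // l.
  have := congr1 (fun w => cyc w (l + size z - i)) e.
  rewrite !cyc_rot 1?ltnW // subnK; last by lia.
  have -> : l + size z - i + j = l + (j - i) + size z by lia.
  by rewrite !cyc_period.
have ji : j - i < size z by lia.
by rewrite /dvdn modn_small // subn_eq0 => {}ji; apply/eqP; rewrite eqn_leq ij.
Qed.

Lemma prim_not_pow z w k : prim z -> 1 < k -> z <> pow w k.
Proof.
move=> [z0 hz] k1 zE; have k0 : 0 < k by exact: ltnW.
have zs : size z = k * size w by rewrite zE size_pow.
have w0 : 0 < size w by move: z0; rewrite zs; case: (size w) => //; rewrite muln0.
have hp : period (cyc z) (size w) by move=> i; rewrite zE !cyc_pow // cyc_period.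
by have := hz _ w0 hp; rewrite zs leqNgt ltn_Pmull.
Qed.

End Periods.

(** * Counting words by the orbit of their primitive root *)

Section CyclicCount.
Variables (E : finType) (x0 : E) (good : pred (seq E)) (O : eqType).
Variables (Phi : seq E -> O) (len : O -> nat) (m : nat) (Os : seq O).
Local Open Scope nat_scope.
Hypotheses (good_rot : forall i w, good (rot i w) = good w)
  (good_pow : forall w k, 0 < k -> good (pow w k) = good w)
  (Phi_len : forall z, good z -> prim x0 z -> len (Phi z) = size z)
  (PhiP : forall z z', good z -> prim x0 z -> good z' -> prim x0 z' ->
     (Phi z = Phi z' <-> roteq z z'))
  (Os_uniq : uniq Os)
  (OsP : forall o, o \in Os ->
     exists z, [/\ good z, prim x0 z & Phi z = o])
  (Os_mem : forall z, good z -> prim x0 z -> size z <= m -> Phi z \in Os)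
  (m_gt0 : 0 < m).

(* A word of length [m] is a power of a unique primitive word; the words whose
   primitive root lies over [o] are the powers of the [len o] rotations of one
   of them. *)
Lemma count_good_words :
  #|[set w : m.-tuple E | good w]%SET| =
  \sum_(o <- Os) len o * (len o %| m).
Proof.
pose R (w : m.-tuple E) (o : O) :=
  `[< exists z k, [/\ prim x0 z, 0 < k, tval w = pow z k, good z & Phi z = o] >].
have Runiq (w : m.-tuple E) : \sum_(o <- Os) R w o = good w.
  have w0 : 0 < size w by rewrite size_tuple.
  have [z [k [zp k0 wE]]] := prim_root_exists x0 w0.
  have gzE : good w = good z by rewrite wE good_pow.
  have [gz|gz] := boolP (good z); last first.
    rewrite gzE (negPf gz) big1 // => o _; apply/eqP; rewrite eqb0.
    apply/asboolP => -[z' [k' [zp' k0' wE' gz' _]]]; move: gz.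
    by rewrite -gzE wE' good_pow // gz'.
  have Rz o : R w o = (o == Phi z).
    apply/asboolP/eqP => [[z' [k' [zp' k0' wE' gz' <-]]]|->]; last by exists z, k.
    by congr Phi; apply: (prim_pow_inj zp' zp k0' k0); rewrite -wE -wE'.
  rewrite gzE gz (bigD1_seq (Phi z)) //=.
    rewrite Rz eqxx big1 // => o /negPf on; by rewrite Rz on.
  apply: Os_mem => //; rewrite -[X in _ <= X](size_tuple w) wE size_pow.
  exact: leq_pmull.
rewrite -sum1dep_card [LHS]big_mkcond /=.
rewrite (eq_bigr (fun w : m.-tuple E => \sum_(o <- Os) (R w o : nat))); last first.
  by move=> w _; rewrite Runiq; case: good.
rewrite exchange_big /=; apply: eq_big_seq => o /OsP [z [gz zp zo]].
have zl : len o = size z by rewrite -zo Phi_len.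
have -> : \sum_w R w o = #|[set w | R w o]%SET|.
  by rewrite -sum1dep_card [RHS]big_mkcond /=; apply: eq_bigr => w _; case: (R w o).
have [lm|lm] := boolP (len o %| m); last first.
  rewrite muln0; apply: eq_card0 => w; rewrite !inE; apply/negbTE.
  apply: contra lm => /asboolP[z' [k [zp' k0 wE gz' z'o]]].
  rewrite -z'o Phi_len // -(size_tuple w) wE size_pow; exact: dvdn_mull.
rewrite muln1; have z0 := zp.1.
have lm' : size z %| m by rewrite -zl.
have k0 : 0 < m %/ size z by rewrite (divn_gt0 _ z0); apply: dvdn_leq.
have hsz (i : 'I_(len o)) : size (pow (rot i z) (m %/ size z)) == m.
  by rewrite size_pow size_rot (divnK lm').
pose h (i : 'I_(len o)) : m.-tuple E := Tuple (hsz i).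
have h_inj : injective h.
  move=> i j /(congr1 val) /= e; apply/val_inj.
  have re := prim_pow_inj (prim_rot i zp) (prim_rot j zp) k0 k0 e.
  by apply: (prim_rot_inj zp) re; rewrite -zl ltn_ord.
rewrite -[RHS]card_ord -(card_imset _ h_inj); apply: eq_card => w.
rewrite inE; apply/asboolP/imsetP => [[z' [k [zp' k1 wE gz' z'o]]]|[i _ ->]].
  have /(PhiP gz zp gz' zp') [i z'E] : Phi z = Phi z' by rewrite zo z'o.
  have [j jz jE] := rot_bounded i z.
  (* [rot_bounded] allows [j = size z], which is the trivial rotation and must be counted as index
     [0]. *)
  have jlt : (if j == size z then 0 else j) < len o.
    by rewrite zl; case: eqP => // /eqP jn; rewrite ltn_neqAle jn.
  exists (Ordinal jlt) => //; apply/val_inj => /=.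
  have -> : rot (if j == size z then 0 else j) z = z'.
    rewrite z'E jE; case: eqP => // ->; by rewrite rot_size rot0.
  rewrite wE; congr (pow _ _); rewrite -(size_tuple w) wE size_pow.
  by rewrite z'E size_rot mulnK.
exists (rot i z), (m %/ size z); split; rewrite ?good_rot //; first exact: prim_rot.
apply: etrans zo; apply/esym/(PhiP gz zp); rewrite ?good_rot //.
  exact: prim_rot.
by exists i.
Qed.

End CyclicCount.

(** * Free homotopy classes of closed paths *)

Section Homotopy.
Variables (V E : choiceType) (Y : graph V E).
Implicit Types (c d : V * seq E) (v w : V) (s t : seq E) (e : E).
Notation nobtY := (nobt (einv Y)).
Notation nfY := (nf (einv Y)).

Lemma walk_cat v s t w :
  walk Y v (s ++ t) w <-> exists2 x, walk Y v s x & walk Y x t w.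
Proof.
elim: s v => [|e s IH] v /=.
  by split=> [h|[x /eqP -> //]]; exists v.
split=> [/andP[ev /IH [x h1 h2]]|[x /andP[ev h1] h2]].
  by exists x; rewrite ?ev.
by rewrite ev; apply/IH; exists x.
Qed.

Lemma walk_backtrack v a e b w :
  walk Y v (a ++ e :: einv Y e :: b) w -> walk Y v (a ++ b) w.
Proof.
move=> /walk_cat [x h /= /and3P[/eqP xe _ hb]]; apply/walk_cat; exists x => //.
by rewrite term_einv in hb; rewrite -xe.
Qed.

Lemma walk_uniq v s w w' : walk Y v s w -> walk Y v s w' -> w = w'.
Proof.
elim: s v => [|e s IH] v /=; first by move=> /eqP <- /eqP <-.
by move=> /andP[_ h] /andP[_ h']; apply: IH h h'.
Qed.

Lemma fh_closed c d : free_homotopic Y c d -> closed_path Y c /\ closed_path Y d.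
Proof.
elim=> {c d} [c h|c d _ [h1 h2]|c d f _ [h1 h2] _ [h3 h4]|v s1 s2 e h1 h2|v e s h].
- by [].
- by [].
- by [].
- by [].
split=> //; move: h; rewrite /closed_path /= -cats1 => /andP[/eqP ev h].
by apply/walk_cat; exists v => //=; rewrite ev !eqxx.
Qed.

Lemma fh_nf c d : free_homotopic Y c d -> roteq (nfY c.2) (nfY d.2).
Proof.
elim=> {c d} [c h|c d _ h|c d f _ h1 _ h2|v s1 s2 e _ _|v e s _] /=.
- exact: roteq_refl.
- exact: roteq_sym.
- exact: roteq_trans h1 h2.
- by rewrite (nf_backtrack (einvK Y)); apply: roteq_refl.
- exact/roteq_sym/(nf_rotate (einvK Y)).
Qed.

(** A reduced path that is not cyclically reduced has cancelling ends, and one rotation brings them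
    together as a backtrack. *)
Lemma fh_cyc_reduced c : closed_path Y c ->
  exists2 d, free_homotopic Y c d & cycle nobtY d.2.
Proof.
case: c => v s; have [n] := ubnP (size s); elim: n v s => // n IH v s sn hc.
have [hs|/not_reduced [a [e [b sE]]]] := boolP (reduced (einv Y) s); last first.
  have hc' : closed_path Y (v, a ++ b).
    by apply: (@walk_backtrack v a e b v); rewrite -sE; apply: hc.
  have [|d cd hd] := IH v (a ++ b) _ hc'.
    by move: sn; rewrite sE !size_cat /= !addnS => /ltnW.
  exists d => //; apply: fh_trans cd; rewrite sE; apply: fh_backtrack => //.
  by rewrite /= -sE.
have [cs|[e [t st]]] := reduced_cases (einvK Y) (einv_neq Y) hs.
  by exists (v, s) => //; apply: fh_refl.
have h1 : free_homotopic Y (v, s) (term Y e, rcons (rcons t (einv Y e)) e).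
  by rewrite st; apply: fh_rotate; rewrite -st.
have tE : rcons (rcons t (einv Y e)) e =
          t ++ [:: einv Y e; einv Y (einv Y e)] ++ [::].
  by rewrite (einvK Y) -cats1 -cats1 -catA.
have [_ h2] := fh_closed h1; rewrite tE in h1 h2.
have h3 : closed_path Y (term Y e, t ++ [::]) := walk_backtrack h2.
have tn : (size t < n)%N by move: sn; rewrite st /= size_rcons ltnS => /ltnW.
have h4 : closed_path Y (term Y e, t) by rewrite -[t]cats0.
have [d cd hd] := IH _ _ tn h4.
exists d => //; apply: fh_trans cd; apply: fh_trans h1 _.
by rewrite -[X in free_homotopic _ _ (_, X)]cats0; apply: fh_backtrack.
Qed.

Lemma fh_rot c i : closed_path Y c ->
  exists v, free_homotopic Y c (v, rot i c.2).
Proof.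
case: c => v s hc /=; have [ss|ss] := leqP i (size s); last first.
  by rewrite rot_oversize 1?ltnW //; exists v; apply: fh_refl.
elim: i ss => [|i IH] ss; first by rewrite rot0; exists v; apply: fh_refl.
have [w hw] := IH (ltnW ss); rewrite -addn1 addnC rotD ?addn1 1?addnC ?addn1 //.
have [_] := fh_closed hw.
have : (0 < size (rot i s))%N by rewrite size_rot (leq_ltn_trans _ ss).
case E0 : (rot i s) => [|e t] //= _ hc'; rewrite rot1_cons; exists (term Y e).
by apply: fh_trans hw _; rewrite E0; apply: fh_rotate.
Qed.

Lemma homotopy_classE c d : free_homotopic Y c d ->
  homotopy_class Y c = homotopy_class Y d.
Proof.
move=> cd; rewrite /homotopy_class; apply/seteqP; split=> x /= h.
  exact: fh_trans (fh_sym cd) h.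
exact: fh_trans cd h.
Qed.

Lemma homotopy_class_inj c d : closed_path Y d ->
  homotopy_class Y c = homotopy_class Y d -> free_homotopic Y c d.
Proof.
move=> hd cd; have : homotopy_class Y d d by apply: fh_refl.
by rewrite -cd.
Qed.

(** All members of the class have normal forms of the same size, and a normal form is never longer
    than its path. *)
Lemma class_lenE c : closed_path Y c -> cycle nobtY c.2 ->
  class_len (homotopy_class Y c) = size c.2.
Proof.
move=> hc cc; rewrite /class_len.
have hmin d : homotopy_class Y c d -> (size c.2 <= size d.2)%N.
  move=> /fh_nf /roteq_size; rewrite nf_cycle // => ->; exact: size_nf.
have hcc : homotopy_class Y c c by apply: fh_refl.
apply: xget_unique => /= [|n [[d hd <-] hn]].
  by split=> //; exists c.
by apply/eqP; rewrite eqn_leq hn // hmin.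
Qed.

Lemma cyc_reduced_homotopic c d : cycle nobtY c.2 -> cycle nobtY d.2 ->
  free_homotopic Y c d -> roteq c.2 d.2.
Proof. by move=> hc hd /fh_nf; rewrite !nf_cycle. Qed.

Lemma path_nonback x e s :
  path (nonback Y) e (rcons s x) =
  walk Y (term Y e) s (org Y x) && path nobtY e (rcons s x).
Proof.
elim: s e => [|f s IH] e /=; first by rewrite !andbT.
rewrite IH /nonback /nobt [org Y f == _]eq_sym.
by case: (term Y e == _) => //=; rewrite andbCA.
Qed.

Lemma closed_cycle c : closed_path Y c -> cycle nobtY c.2 ->
  cycle (nonback Y) c.2.
Proof.
case: c => v [|e s] //; rewrite /closed_path /= => /andP[/eqP <- h] h'.
by rewrite path_nonback h.
Qed.

Lemma cycle_closed e s : cycle (nonback Y) (e :: s) ->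
  closed_path Y (org Y e, e :: s).
Proof. by rewrite /closed_path /= eqxx path_nonback => /andP[]. Qed.

Variable a : zaction Y.

Lemma walk_act k v s w :
  walk Y (actV a k v) (map (actE a k) s) (actV a k w) = walk Y v s w.
Proof.
have actK : injective (actV a k).
  by apply: (can_inj (g := actV a (- k))) => y; rewrite -actVD addNr actV0.
elim: s v => [|e s IH] v /=; first by rewrite (inj_eq actK).
by rewrite /term (act_einv a) !(act_org a) (inj_eq actK) IH.
Qed.

Lemma fh_act k c d : free_homotopic Y c d ->
  free_homotopic Y (act_path a k c) (act_path a k d).
Proof.
elim=> {c d} [c h|c d _ h|c d f _ h1 _ h2|v s1 s2 e h1 h2|v e s h].
- by apply: fh_refl; rewrite /closed_path /= walk_act.
- exact: fh_sym.
- exact: fh_trans h1 h2.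
- rewrite /act_path /= !map_cat /= -(act_einv a).
  apply: fh_backtrack.
    by rewrite /closed_path /= -map_cat walk_act.
  move: h2; rewrite /closed_path /= -(walk_act k) !map_cat /= -(act_einv a) //.
- rewrite /act_path /= map_rcons /term -(act_org a) -(act_einv a).
  by apply: fh_rotate; apply: etrans (walk_act k v (e :: s) v) h.
Qed.

Lemma act_pathK k : cancel (act_path a k) (act_path a (- k)).
Proof.
move=> [v s]; rewrite /act_path /= -actVD addNr actV0 -map_comp.
by congr pair; apply: map_id_in => e _; rewrite /= -actED addNr actE0.
Qed.

Lemma act_pathD k l c : act_path a (k + l) c = act_path a k (act_path a l c).
Proof.
case: c => v s; rewrite /act_path /= actVD -map_comp; congr pair.
by apply: eq_map => e; rewrite /= actED.
Qed.

Lemma act_path0 c : act_path a 0 c = c.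
Proof.
case: c => v s; rewrite /act_path /= actV0; congr pair.
by apply: map_id_in => e _; rewrite actE0.
Qed.

Lemma act_homotopy_class k c :
  act_class a k (homotopy_class Y c) = homotopy_class Y (act_path a k c).
Proof.
apply/seteqP; split=> d /= => [[d' hd' <-]|hd]; first exact: fh_act.
exists (act_path a (- k) d); last by rewrite -{1}[k]opprK act_pathK.
by rewrite /homotopy_class /= -[c](act_pathK k); apply: fh_act.
Qed.

Lemma class_orbit_act k c :
  class_orbit a (homotopy_class Y (act_path a k c)) =
  class_orbit a (homotopy_class Y c).
Proof.
apply/seteqP; split=> g /= [l _ <-].
  by exists (l + k) => //; rewrite !act_homotopy_class act_pathD.
exists (l - k) => //.
by rewrite !act_homotopy_class -act_pathD subrK.
Qed.

Hypothesis a_free : free_action a.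

Lemma freeV k l y : actV a k y = actV a l y -> k = l.
Proof.
move=> h; apply/eqP; rewrite -subr_eq0; apply/eqP/(a_free (y := y)).
by rewrite addrC actVD h -actVD addNr actV0.
Qed.

Lemma freeE k l e : actE a k e = actE a l e -> k = l.
Proof. by move=> /(congr1 (org Y)); rewrite !(act_org a); apply: freeV. Qed.

(* If [t^k] rotates the edges of a cycle, all [t^(k*i)]-translates of an edge lie
   on it. *)
Lemma roteq_act k s : s != [::] -> roteq s (map (actE a k) s) -> k = 0.
Proof.
case: s => // e s _ [i hi]; set t := e :: s in hi.
apply/eqP/negPn/negP => k0.
pose r := [seq actE a (k *+ j) e | j <- iota 0 (size t).+1].
have ru : uniq r.
  by rewrite map_inj_uniq ?iota_uniq // => j l /freeE /(mulrIn k0).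
have rt : {subset r <= t}.
  move=> _ /mapP [j _ ->]; elim: j => [|j IH]; first by rewrite mulr0n actE0 mem_head.
  by rewrite mulrS actED -(mem_rot i) -hi map_f.
by have := uniq_leq_size ru rt; rewrite size_map size_iota ltnn.
Qed.

(** Homotopic cyclically reduced paths are rotations of each other, which reduces the claim to
    [roteq_act]. *)
Lemma class_stabE c : closed_path Y c -> cycle nobtY c.2 -> c.2 != [::] ->
  class_stab a (homotopy_class Y c) = [set 0].
Proof.
move=> hc cc c0; apply/seteqP; split=> k /=; last first.
  by move=> ->; rewrite /class_stab /= act_homotopy_class act_path0.
rewrite /class_stab /= act_homotopy_class => /(homotopy_class_inj hc) /fh_sym h.
apply: (roteq_act c0); apply: cyc_reduced_homotopic h => //=.
rewrite cycle_map; apply: sub_cycle cc => x y /=; apply: contra => /eqP.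
rewrite (act_einv a) => /(congr1 (actE a (- k))).
by rewrite -!actED addNr !actE0 => ->.
Qed.

End Homotopy.

(** * Voltages and orbits of primitive classes *)

Section Lifts.
Variables (VX EX : finType) (X : graph VX EX) (VY EY : choiceType) (Y : graph VY EY).
Variables (a : zaction Y) (a_free : free_action a) (p : graph_map Y X).
Variables (p_quot : quotient_map a p) (s : VX -> VY).
Hypothesis s_lift : forall x, mapV p (s x) = x.

Lemma map_term e : term X (mapE p e) = mapV p (term Y e).
Proof. by rewrite /term (map_einv p) (map_org p). Qed.

Lemma mapE_act k e : mapE p (actE a k e) = mapE p e.
Proof. by have [_ _ _ h] := p_quot; apply/esym/h; exists k. Qed.

Lemma mapV_act k y : mapV p (actV a k y) = mapV p y.
Proof. by have [_ _ h _] := p_quot; apply/esym/h; exists k. Qed.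

Lemma base_lift y : exists k, y = actV a k (s (mapV p y)).
Proof. by have [_ _ h _] := p_quot; apply/h; rewrite s_lift. Qed.

Lemma lift_edge_uniq e e' : mapE p e = mapE p e' -> org Y e = org Y e' -> e = e'.
Proof.
have [_ _ _ h] := p_quot; move=> /h [k ->]; rewrite (act_org a) => /esym/a_free ->.
by rewrite actE0.
Qed.

(** A voltage assignment of the covering: [volt f] counts the sheets crossed by the lift of [f], so
    that a closed walk of [X] lifts to a closed path exactly when its voltages sum to zero. *)
Definition is_voltage (lft : EX -> EY) (volt : EX -> int) := forall f,
  [/\ mapE p (lft f) = f, org Y (lft f) = s (org X f)
    & term Y (lft f) = actV a (volt f) (s (term X f))].

Lemma voltage_exists : exists lft volt, is_voltage lft volt.
Proof.
have [_ surjE _ _] := p_quot.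
have h f : exists ek : EY * int, [/\ mapE p ek.1 = f, org Y ek.1 = s (org X f)
    & term Y ek.1 = actV a ek.2 (s (term X f))].
  have [e0 e0f] := surjE f; have [k kE] := base_lift (org Y e0).
  pose e := actE a (- k) e0.
  have ef : mapE p e = f by rewrite mapE_act.
  have [l lE] := base_lift (term Y e); exists (e, l); split=> //=.
    by rewrite (act_org a) kE -(map_org p) e0f -actVD addNr actV0.
  by rewrite {1}lE -map_term ef.
have [F hF] := choice h.
by exists (fst \o F), (snd \o F) => f; apply: hF.
Qed.

Variables (lft : EX -> EY) (volt : EX -> int).
Hypothesis voltP : is_voltage lft volt.

(** The reversed lift of [f] starts in sheet [volt f]; translated back to sheet [0], it is the lift
    of the reversed edge by unique lifting. *)
Lemma volt_einv f : volt (einv X f) = - volt f.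
Proof.
have [fp fo ft] := voltP f; have [gp go gt] := voltP (einv X f).
have e : lft (einv X f) = actE a (- volt f) (einv Y (lft f)).
  apply: lift_edge_uniq; first by rewrite gp mapE_act -(map_einv p) fp.
  by rewrite go (act_org a) -/(term Y (lft f)) ft -actVD addNr actV0.
apply: (freeV a_free (y := s (org X f))).
rewrite -[in LHS](term_einv X) -gt e /term (act_einv a) (act_org a) (einvK Y).
by rewrite fo.
Qed.

Definition vol (w : seq EX) := \sum_(f <- w) volt f.

Fixpoint liftw j (w : seq EX) : seq EY :=
  if w is f :: w' then actE a j (lft f) :: liftw (j + volt f) w' else [::].

Lemma map_liftw j w : map (mapE p) (liftw j w) = w.
Proof. by elim: w j => //= f w IH j; rewrite IH mapE_act; have [->] := voltP f. Qed.

Lemma vol_cons f w : vol (f :: w) = volt f + vol w.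
Proof. exact: big_cons. Qed.

Lemma walk_liftw j x w y : walk X x w y ->
  walk Y (actV a j (s x)) (liftw j w) (actV a (j + vol w) (s y)).
Proof.
elim: w j x => [|f w IH] j x /=.
  by move=> /eqP ->; rewrite /vol big_nil addr0.
move=> /andP[/eqP <- h]; have [_ fo ft] := voltP f.
rewrite (act_org a) fo eqxx /= vol_cons addrA {1}/term (act_einv a) (act_org a).
by rewrite -/(term Y (lft f)) ft -actVD; apply: IH.
Qed.

Lemma walk_lift_uniq v t w t' w' : walk Y v t w -> walk Y v t' w' ->
  map (mapE p) t = map (mapE p) t' -> t = t'.
Proof.
elim: t v t' => [|e t IH] v [|e' t'] //= /andP[/eqP ev h] /andP[/eqP ev' h'] [ee' tt'].
have {}ee' : e = e' by apply: lift_edge_uniq => //; rewrite ev ev'.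
by rewrite -ee' in h' *; rewrite (IH _ _ h h').
Qed.

Lemma walk_map v t w : walk Y v t w -> walk X (mapV p v) (map (mapE p) t) (mapV p w).
Proof.
elim: t v => [|e t IH] v /=; first by move=> /eqP ->.
by move=> /andP[/eqP <- h]; rewrite (map_org p) eqxx /= map_term; apply: IH.
Qed.

Lemma closed_liftP c : closed_path Y c -> exists j,
  c = (actV a j (s (mapV p c.1)), liftw j (map (mapE p) c.2)) /\
  vol (map (mapE p) c.2) = 0.
Proof.
case: c => v t; rewrite /closed_path /= => hc.
have [j vE] := base_lift v; exists j; set x := mapV p v in vE *.
set w := map _ t; have hw := walk_map hc; rewrite -/w -/x in hw.
have hl := walk_liftw j hw; rewrite -vE in hl.
have tE : t = liftw j w by apply: walk_lift_uniq hc hl _; rewrite map_liftw.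
split; first by rewrite {1}vE {1}tE.
have := walk_uniq hc (w' := actV a (j + vol w) (s x)).
rewrite {1}tE => /(_ hl); rewrite {1}vE => /(freeV a_free).
by move=> /eqP; rewrite -subr_eq0 opprD addrA subrr sub0r oppr_eq0 => /eqP.
Qed.

Lemma act_liftw k j w : map (actE a k) (liftw j w) = liftw (k + j) w.
Proof. by elim: w j => //= f w IH j; rewrite -actED IH addrA. Qed.

Lemma liftw_cat j w w' : liftw j (w ++ w') = liftw j w ++ liftw (j + vol w) w'.
Proof.
elim: w j => [|f w IH] j /=; first by rewrite /vol big_nil addr0.
by rewrite IH vol_cons addrA.
Qed.

Lemma vol_cat w w' : vol (w ++ w') = vol w + vol w'.
Proof. exact: big_cat. Qed.

Lemma vol_pow w k : vol (pow w k) = vol w *+ k.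
Proof.
elim: k => [|k IH]; first by rewrite mulr0n /vol big_nil.
by rewrite powS vol_cat IH mulrS.
Qed.

Lemma liftw_pow j w k : vol w = 0 -> liftw j (pow w k) = pow (liftw j w) k.
Proof. by move=> w0; elim: k => // k IH; rewrite !powS liftw_cat w0 addr0 IH. Qed.

Definition good (w : seq EX) := cycle (nonback X) w && (vol w == 0).

Lemma good_rot i w : good (rot i w) = good w.
Proof.
by rewrite /good rot_cycle /vol (perm_big w) // perm_rot.
Qed.

Lemma cycle_powE (r : rel EX) w k : (0 < k)%N -> cycle r (pow w k) = cycle r w.
Proof.
case: k => // k _; apply/idP/idP => [|h]; last exact: cycle_pow.
case: w => // e w; rewrite !(cycle_path e).
have -> : last e (pow (e :: w) k.+1) = last e w.
  by elim: k => [|k IH]; [rewrite powS cats0 | rewrite powS last_cat /= -IH; elim: {+}k].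
by rewrite powS cat_path => /andP[].
Qed.

Lemma good_pow w k : (0 < k)%N -> good (pow w k) = good w.
Proof. by move=> k0; rewrite /good cycle_powE // vol_pow mulrn_eq0 -leqn0 leqNgt k0. Qed.

Notation nobtY := (nobt (einv Y)).
Arguments liftw : simpl never.

Lemma good_lift f w j : good (f :: w) ->
  closed_path Y (actV a j (s (org X f)), liftw j (f :: w)) /\
  cycle nobtY (liftw j (f :: w)).
Proof.
move=> /andP[cw /eqP v0]; split.
  have /walk_liftw -/(_ j) := cycle_closed cw.
  by rewrite v0 addr0.
have : cycle (nobt (einv X)) (map (mapE p) (liftw j (f :: w))).
  by rewrite map_liftw; apply: sub_cycle cw => x y /andP[].
rewrite cycle_map; apply: sub_cycle => x y /=; rewrite /nobt; apply: contra.
by move=> /eqP ->; rewrite (map_einv p).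
Qed.

Lemma act_lift k f w : act_path a k (s (org X f), liftw 0 (f :: w)) =
  (actV a k (s (org X f)), liftw k (f :: w)).
Proof. by rewrite /act_path act_liftw addr0. Qed.

(** Sheet [0] is an arbitrary choice, since the orbit contains all translates. The value on the
    empty word is a dummy: primitive words are nonempty. *)
Definition word_orbit (w : seq EX) : set (set (VY * seq EY)) :=
  if w is f :: _ then
    class_orbit a (homotopy_class Y (s (org X f), liftw 0 w)) else set0.

Definition orbit_len (o : set (set (VY * seq EY))) : nat := class_len (xget set0 o).

Lemma word_orbit_mem f w : good (f :: w) -> exists k,
  xget set0 (word_orbit (f :: w)) =
  homotopy_class Y (actV a k (s (org X f)), liftw k (f :: w)).
Proof.
move=> gw; have : word_orbit (f :: w) (homotopy_class Y (s (org X f), liftw 0 (f :: w))).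
  by exists 0 => //; rewrite act_homotopy_class act_path0.
move=> /(xgetI set0) [k _ <-]; exists k.
by rewrite act_homotopy_class act_lift.
Qed.

Lemma word_orbit_len w : good w -> (0 < size w)%N -> orbit_len (word_orbit w) = size w.
Proof.
case: w => // f w gw _; have [k] := word_orbit_mem gw; rewrite /orbit_len => ->.
have [h1 h2] := good_lift k gw; rewrite class_lenE //.
by rewrite -[in RHS](map_liftw k (f :: w)) size_map.
Qed.

Lemma word_orbit_stab w : good w -> (0 < size w)%N ->
  class_stab a (xget set0 (word_orbit w)) = [set 0].
Proof.
case: w => // f w gw _; have [k ->] := word_orbit_mem gw.
by have [h1 h2] := good_lift k gw; rewrite (class_stabE a_free).
Qed.

Lemma roteq_map (T T' : eqType) (h : T -> T') t t' :
  roteq t t' -> roteq (map h t) (map h t').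
Proof. by move=> [i ->]; exists i; rewrite map_rot. Qed.

(** Forward, homotopic lifts are rotations of each other and project to rotations. Backward, a
    rotated lift is still closed, hence by unique lifting a translate of the lift of [z']. *)
Lemma word_orbitP z z' : good z -> (0 < size z)%N -> good z' -> (0 < size z')%N ->
  word_orbit z = word_orbit z' <-> roteq z z'.
Proof.
case: z => // f w gz _; case: z' => // f' w' gz' _.
have [cz rz] := good_lift 0 gz; rewrite actV0 in cz.
split=> [h|[i hi]].
  have : word_orbit (f :: w) (homotopy_class Y (s (org X f), liftw 0 (f :: w))).
    by exists 0 => //; rewrite act_homotopy_class act_path0.
  rewrite h => -[k _]; rewrite act_homotopy_class act_lift.
  have [cz' rz'] := good_lift k gz'.
  move=> /(homotopy_class_inj cz) /fh_sym hh.
  have /(roteq_map (mapE p)) := @cyc_reduced_homotopic _ _ _ (_, _) (_, _) rz rz' hh.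
  by rewrite !map_liftw.
have [v hv] := fh_rot i cz.
have [_ cv] := fh_closed hv; have [j [cE _]] := closed_liftP cv.
have vE : mapV p v = org X f'.
  have := walk_map cv; rewrite /= map_rot map_liftw -hi /=.
  by move=> /andP[/eqP ->].
rewrite /= map_rot map_liftw -hi vE in cE.
rewrite /word_orbit (homotopy_classE hv) cE -act_lift class_orbit_act //.
Qed.

(** A cyclically reduced representative projects to a good word [z], and [z] must be primitive: if
    it is the [k]-th power of [z1], then [k vol z1 = 0] forces [vol z1 = 0], so [z1] lifts to a
    closed path whose [k]-th power is the given one. Absence of torsion in the group of voltages is
    what makes this work. *)
Lemma primitive_orbit_word x0 o : primitive_orbits a o ->
  exists z, [/\ good z, prim x0 z & word_orbit z = o].
Proof.
move=> [g [c [hc hprim] <-] <-].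
have [d cd hd] := fh_cyc_reduced hc; have [_ cld] := fh_closed cd.
have [j [dE v0]] := closed_liftP cld; set z := map (mapE p) d.2 in dE v0.
have d0 : (0 < size d.2)%N.
  rewrite lt0n; apply/negP => /eqP/size0nil d20.
  apply: (hprim (d.1, [::]) 2) => //; first by rewrite /closed_path /= eqxx.
  by rewrite /path_pow /= -d20; case: (d) cd.
have z0 : (0 < size z)%N by rewrite size_map.
have cz : cycle (nonback X) z.
  rewrite cycle_map; apply: sub_cycle (closed_cycle cld hd) => x y /=.
  rewrite /nonback => /andP[/eqP xy hn]; rewrite map_term (map_org p) xy eqxx /=.
  apply: contra hn => /eqP h; apply/eqP/lift_edge_uniq; last by rewrite -xy.
  by rewrite h (map_einv p).
have gz : good z by rewrite /good cz v0 eqxx.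
have [z1 [k [z1p k0 zE]]] := prim_root_exists x0 z0.
have gz1 : good z1 by move: gz; rewrite zE good_pow.
have k1 : k = 1%N.
  apply/eqP; rewrite eqn_leq k0 andbT leqNgt; apply/negP => k2.
  case: z1 z1p zE gz1 => [[] //|f1 w1] z1p zE gz1.
  have [cl1 _] := good_lift j gz1.
  apply: (hprim _ k cl1 k2); apply: (fh_trans cd).
  suff <- : d = path_pow (actV a j (s (org X f1)), liftw j (f1 :: w1)) k.
    exact: fh_refl.
  rewrite /path_pow -[flatten _]/(pow (liftw j (f1 :: w1)) k) -liftw_pow.
    rewrite -zE dE; congr pair; congr (actV _ _ (s _)).
    have := walk_map cld; rewrite -/z zE; case: (k) k0 => // k' _ /=.
    by move=> /andP[/eqP].
  by apply/eqP; case/andP: gz1.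
exists z; split=> //; first by rewrite zE k1 /pow /= cats0.
rewrite (homotopy_classE cd).
case zf : z => [|f w]; first by rewrite zf in z0.
have vE : mapV p d.1 = org X f.
  by have := walk_map cld; rewrite -/z zf /= => /andP[/eqP].
by rewrite dE vE zf -act_lift class_orbit_act.
Qed.

(** By [nf_pow], a homotopy from the lift to a [k]-th power would make a rotation of the word itself
    a [k]-th power. *)
Lemma word_orbit_primitive x0 z : good z -> prim x0 z ->
  primitive_orbits a (word_orbit z).
Proof.
case: z => [_ []//|f w] gz zp.
have [cz rz] := good_lift 0 gz; rewrite actV0 in cz.
exists (homotopy_class Y (s (org X f), liftw 0 (f :: w))) => //.
eexists; last by []; split=> // d k cd k2 /fh_nf; rewrite nf_cycle //=.
have [t _ /(_ k) h1] := nf_pow (einvK Y) (einv_neq Y) d.2 => h2.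
have [i hi] := roteq_trans h2 h1.
have : rot i (f :: w) = pow (map (mapE p) t) k.
  rewrite -(map_liftw 0 (f :: w)) -map_rot -hi /pow map_flatten.
  by rewrite map_nseq.
exact: (prim_not_pow (prim_rot i zp) k2).
Qed.

Lemma primitive_orbit_edge o : primitive_orbits a o -> exists f : EX, True.
Proof.
move=> [g [[v [|e t]] [hc hprim] _] _]; last by exists (mapE p e).
by exfalso; apply: (hprim (v, [::]) 2) => //; apply: fh_refl.
Qed.

(* The number of cyclically reduced closed paths of length [m] in [Y], up to
   translation. *)
Definition num_closed m := #|[set w : m.-tuple EX | good w]%SET|.

Lemma orbit_counting M : exists Os : seq (set (set (VY * seq EY))),
  [/\ uniq Os,
      forall o, o \in Os <-> primitive_orbits a o /\ (orbit_len o < M)%N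
    & forall m, (0 < m < M)%N ->
      num_closed m = (\sum_(o <- Os) orbit_len o * (orbit_len o %| m))%N].
Proof.
(* Words need a default edge. Without edges there are neither primitive orbits nor words of positive
   length. *)
have [x0 _|E0] := pickP (@predT EX); last first.
  have no o : ~ primitive_orbits a o.
    by move=> /primitive_orbit_edge [f _]; have := E0 f.
  exists [::]; split=> // [o|m /andP[m0 _]]; first by split=> // -[/no].
  rewrite big_nil; apply: eq_card0 => -[[|f w]] //; last by have := E0 f.
  by move=> h; exfalso; move: m0 (h); rewrite /= lt0n eq_sym => /negPf ->.
pose ws := [seq tval w | m <- iota 1 M.-1, w : m.-tuple EX <- enum {: m.-tuple EX}].
pose Os := undup [seq word_orbit z | z <- ws & good z && `[< prim x0 z >]].
have mem_ws z : (0 < size z < M)%N -> z \in ws.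
  move=> h; apply/allpairsPdep; exists (size z), (in_tuple z).
  rewrite mem_enum mem_iota; split=> //; lia.
have ws_mem z : z \in ws -> (size z < M)%N.
  by move=> /allpairsPdep [m [w [+ _ ->]]]; rewrite mem_iota size_tuple; lia.
have OsP o : o \in Os <-> primitive_orbits a o /\ (orbit_len o < M)%N.
  rewrite mem_undup; split.
    move=> /mapP [z]; rewrite mem_filter => /andP[/andP[gz /asboolP zp] /ws_mem zM] ->.
    by split; [exact: word_orbit_primitive zp | rewrite word_orbit_len //; case: zp].
  move=> [/(primitive_orbit_word x0) [z [gz zp <-]]].
  have z0 : (0 < size z)%N by case: zp.
  rewrite word_orbit_len // => zM; apply: map_f; rewrite mem_filter gz /=.
  by rewrite mem_ws ?z0 // andbT; apply/asboolP.
exists Os; split=> //; first exact: undup_uniq.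
move=> m /andP[m0 mM].
apply: (@count_good_words EX x0 good _ word_orbit orbit_len m Os) => //.
- exact: good_rot.
- exact: good_pow.
- by move=> z gz [z0 _]; apply: word_orbit_len.
- by move=> z z' gz [z0 _] gz' [z'0 _]; apply: word_orbitP.
- exact: undup_uniq.
- by move=> o /OsP [/(primitive_orbit_word x0)].
move=> z gz zp zm; have z0 : (0 < size z)%N by case: zp.
apply/OsP; split; first exact: word_orbit_primitive zp.
by rewrite word_orbit_len // (leq_ltn_trans zm).
Qed.

Lemma primitive_orbit_len o : primitive_orbits a o ->
  (0 < orbit_len o)%N /\ class_stab a (xget set0 o) = [set 0].
Proof.
move=> ho; have [x0 _] := primitive_orbit_edge ho.
have [z [gz [z0 _] <-]] := primitive_orbit_word x0 ho.
by rewrite word_orbit_len // word_orbit_stab.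
Qed.

End Lifts.

(** * Traces of the edge matrix *)

Section RootsOfUnity.
Variable C : numClosedFieldType.

Lemma closed_prim_root_exists N : (0 < N)%N -> exists z : C, N.-primitive_root z.
Proof.
move=> N0; pose q : {poly C} := 'X^N - 1; have [r Dq] := closed_field_poly_normal q.
rewrite (monicP _) ?monicXnsubC // scale1r in Dq.
have rn1 : all N.-unity_root r by apply/allP => z; rewrite -root_prod_XsubC -Dq.
have sz_r : (N < (size r).+1)%N.
  by rewrite -(size_prod_XsubC r id) -Dq size_XnsubC.
have [|z] := hasP (has_prim_root N0 rn1 _ sz_r); last by exists z.
by rewrite -separable_prod_XsubC -Dq separable_Xn_sub_1 // pnatr_eq0 -lt0n.
Qed.

Lemma prim_root_prod N (z : C) y : N.-primitive_root z ->
  \prod_(i < N) (1 - z ^+ i * y) = 1 - y ^+ N.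
Proof.
move=> zp; have N0 := prim_order_gt0 zp.
have [->|y0] := eqVneq y 0.
  by rewrite expr0n -leqn0 leqNgt N0 /= subr0 big1 // => i _; rewrite mulr0 subr0.
rewrite (eq_bigr (fun i : 'I_N => y * (y^-1 - z ^+ i))); last first.
  by move=> i _; rewrite mulrBr divff // [y * _]mulrC.
rewrite big_split /= prodr_const card_ord.
have := congr1 (fun q => q.[y^-1]) (factor_Xn_sub_1 zp).
rewrite horner_prod big_mkord !hornerE => e.
rewrite (eq_bigr (fun i : 'I_N => ('X - (z ^+ i)%:P).[y^-1])); last first.
  by move=> i _; rewrite !hornerE.
by rewrite e mulrBr mulr1 -exprMn divff // expr1n.
Qed.

Lemma prim_root_prodV N (z : C) y : N.-primitive_root z ->
  \prod_(i < N) (1 - (z ^+ i)^-1 * y) = 1 - y ^+ N.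
Proof.
move=> zp; have N0 := prim_order_gt0 zp.
have zVE : z^-1 = z ^+ N.-1.
  have z0 : z != 0 by rewrite (prim_root_eq0 zp) -lt0n.
  by apply: (mulfI z0); rewrite divff // -exprS prednK // (prim_expr_order zp).
have zVp : N.-primitive_root z^-1.
  by rewrite zVE prim_root_exp_coprime // coprime_sym -{1}(prednK N0) coprimeSn.
by rewrite -(prim_root_prod _ zVp); apply: eq_bigr => i _; rewrite exprVn.
Qed.

Lemma prim_root_sum N (z : C) (k : int) : N.-primitive_root z -> (`|k| < N)%N ->
  \sum_(i < N) (z ^+ i) ^ k = if k == 0 then N%:R else 0.
Proof.
move=> zp kN; have N0 := prim_order_gt0 zp.
rewrite (eq_bigr (fun i : 'I_N => (z ^ k) ^+ i)); last first.
  by move=> i _; rewrite !exprnP exprzAC.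
have [->|k0] := eqVneq k 0.
  rewrite expr0z (eq_bigr (fun=> 1)) ?sumr_const ?card_ord // => i _.
  by rewrite expr1n.
have zk : z ^ k != 1.
  have : ~~ (N %| `|k|)%N by rewrite gtnNdvd // absz_gt0.
  rewrite (prim_order_dvd zp); case: (k) => n; rewrite ?NegzE ?abszN //.
  by rewrite -exprnN; apply: contra => /eqP h; rewrite -[z ^+ _]invrK h invr1.
have /esym/eqP := subrX1 (z ^ k) N.
have -> : (z ^ k) ^+ N = 1.
  by rewrite exprnP exprzAC -exprnP (prim_expr_order zp) exp1rz.
by rewrite subrr mulf_eq0 subr_eq0 (negPf zk) => /eqP.
Qed.

End RootsOfUnity.

Section Traces.
Variables (C : numClosedFieldType) (VX EX : finType) (X : graph VX EX).
Variable x : EX -> C.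

Lemma sum_tupleS m (F : m.+1.-tuple EX -> C) :
  \sum_w F w = \sum_g \sum_(w : m.-tuple EX) F [tuple of g :: w].
Proof.
rewrite pair_big /= (reindex (fun gw : EX * m.-tuple EX => [tuple of gw.1 :: gw.2])) //=.
exists (fun w => (thead w, [tuple of behead w])) => [[g w] _|w _] /=.
  by rewrite theadE; congr pair; apply: val_inj.
by rewrite [RHS]tuple_eta.
Qed.

Lemma edge_mxX m i j : (edge_mx X x ^+ m) i j =
  \sum_(w : m.-tuple EX) (path (nonback X) (enum_val i) w &&
     (last (enum_val i) w == enum_val j))%:R * \prod_(f <- w) x f.
Proof.
elim: m i j => [|m IH] i j.
  rewrite expr0 mxE (bigD1 [tuple]) //= big_nil mulr1 big1 ?addr0.
    by rewrite enum_val_eq.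
  by move=> w /eqP[]; rewrite [w]tuple0 [RHS]tuple0.
rewrite exprS [LHS]mxE sum_tupleS.
rewrite -(sum_enum_val (fun g => \sum_(w : m.-tuple EX) (path (nonback X) (enum_val i)
   [tuple of g :: w] && (last (enum_val i) [tuple of g :: w] == enum_val j))%:R *
   \prod_(f <- [tuple of g :: w]) x f)).
apply: eq_bigr => k _; rewrite IH mxE mulr_sumr; apply: eq_bigr => w _ /=.
rewrite big_cons; case: (nonback X _ _) => /=; last by rewrite !mul0r.
by rewrite mul1r mulrCA.
Qed.

Lemma trace_edge_mxX m : (0 < m)%N -> \tr (edge_mx X x ^+ m) =
  \sum_(w : m.-tuple EX) (cycle (nonback X) w)%:R * \prod_(f <- w) x f.
Proof.
case: m => // m _; rewrite /mxtrace.
under eq_bigr do rewrite edge_mxX.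
rewrite (sum_enum_val (fun g => \sum_(w : m.+1.-tuple EX) (path (nonback X) g w &&
     (last g w == g))%:R * \prod_(f <- w) x f)) exchange_big /=.
apply: eq_bigr => w _; rewrite -mulr_suml; congr (_ * _).
case: w => -[|g w] //= _.
rewrite (eq_bigr (fun f => (f == last g w)%:R * (path (nonback X) f (g :: w))%:R)).
  rewrite sum_pointed -[path _ _ (rcons _ _)]/(cycle (nonback X) (g :: w)).
  by rewrite (cycle_path g).
by move=> f _; rewrite -natrM mulnb andbC eq_sym.
Qed.

End Traces.

Section VoltageTrace.
Variables (C : numClosedFieldType) (VX EX : finType) (X : graph VX EX).
Variables (volt : EX -> int) (L : nat).
Hypothesis voltL : forall f, (`|volt f| <= L)%N.

(** The sign agrees with [adjacency_entry]: an edge of voltage [c] from [v] to [w] contributes to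
    the coefficient of [t^(-c)]. *)
Definition volt_weight (z : C) (f : EX) : C := z ^ (- volt f).

Lemma abs_vol w : (`|vol volt w| <= size w * L)%N.
Proof.
elim: w => [|f w IH]; first by rewrite /vol big_nil.
rewrite vol_cons /= mulSn; move: (vol volt w) (voltL f) IH => v.
by move: (size w * L)%N => B; lia.
Qed.

Lemma prod_volt_weight z w : z != 0 ->
  \prod_(f <- w) volt_weight z f = z ^ (- vol volt w).
Proof.
move=> z0; elim: w => [|f w IH]; first by rewrite /vol !big_nil oppr0 expr0z.
by rewrite big_cons IH vol_cons opprD expfzDr.
Qed.

(** Summing over the characters of [Z/N] selects the words of voltage zero modulo [N]. A word of
    length [m] has voltage at most [m L < N] in absolute value, so this means voltage zero. *)
Lemma sum_trace N (z : C) m : N.-primitive_root z -> (0 < m)%N -> (m * L < N)%N ->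
  \sum_(i < N) \tr (edge_mx X (volt_weight (z ^+ i)) ^+ m) =
  (N * num_closed X volt m)%:R.
Proof.
move=> zp m0 mL; have N0 := prim_order_gt0 zp.
have z0 : z != 0 by rewrite (prim_root_eq0 zp) -lt0n.
under eq_bigr do rewrite trace_edge_mxX //.
rewrite exchange_big /= /num_closed -sum1dep_card mulnC natrM natr_sum mulr_suml.
rewrite [RHS]big_mkcond /=; apply: eq_bigr => w _.
rewrite (eq_bigr (fun i : 'I_N => (cycle (nonback X) w)%:R *
    (z ^+ i) ^ (- vol volt w))); last first.
  by move=> i _; rewrite prod_volt_weight // expf_neq0.
rewrite -mulr_sumr prim_root_sum //; last first.
  by rewrite abszN (leq_ltn_trans (abs_vol w)) // size_tuple.
rewrite oppr_eq0 /good; case: (cycle _ _) => /=; last by rewrite mul0r.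
by case: eqP; rewrite !mul1r.
Qed.

End VoltageTrace.

(** * Evaluation of the determinant of the Laplacian *)

Lemma tofrac_inj (A : idomainType) : injective (@tofrac A).
Proof. by move=> x y /eqP; rewrite tofrac_eq => /eqP. Qed.

Section FractionEval.
Variables (A : idomainType) (F : fieldType) (ev : {rmorphism A -> F}).
Implicit Types (x y : {fraction A}) (c : F).

(* [ev] extends to the fraction [x], with value [c]. *)
Definition frac_at x c := exists q d,
  [/\ ev d != 0, x * tofrac d = tofrac q & c * ev d = ev q].

Lemma frac_at_uniq x c c' : frac_at x c -> frac_at x c' -> c = c'.
Proof.
move=> [q [d [d0 xd cd]]] [q' [d' [d'0 xd' cd']]].
have /tofrac_inj/(congr1 ev) : tofrac (q * d') = tofrac (q' * d).
  by rewrite !tofracM -xd -xd' mulrAC.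
rewrite !rmorphM -cd -cd' => h.
by apply: (mulIf d0); apply: (mulIf d'0); rewrite h mulrAC.
Qed.

Lemma frac_at_tofrac q : frac_at (tofrac q) (ev q).
Proof. by exists q, 1; rewrite rmorph1 tofrac1 oner_neq0 !mulr1. Qed.

Lemma frac_atD x y c c' : frac_at x c -> frac_at y c' ->
  frac_at (x + y) (c + c').
Proof.
move=> [q [d [d0 xd cd]]] [q' [d' [d'0 xd' cd']]].
exists (q * d' + q' * d), (d * d').
split; first by rewrite rmorphM mulf_neq0.
  by rewrite tofracD !tofracM -xd -xd'; ring.
by rewrite rmorphD !rmorphM -cd -cd'; ring.
Qed.

Lemma frac_atM x y c c' : frac_at x c -> frac_at y c' ->
  frac_at (x * y) (c * c').
Proof.
move=> [q [d [d0 xd cd]]] [q' [d' [d'0 xd' cd']]].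
exists (q * q'), (d * d').
split; first by rewrite rmorphM mulf_neq0.
  by rewrite !tofracM -xd -xd'; ring.
by rewrite !rmorphM -cd -cd'; ring.
Qed.

Lemma frac_atV x c : c != 0 -> frac_at x c -> frac_at x^-1 c^-1.
Proof.
move=> c0 [q [d [d0 xd cd]]]; exists d, q.
have q0 : ev q != 0 by rewrite -cd mulf_neq0.
have x0 : x != 0.
  apply: contraNneq q0 => x0; move: xd; rewrite x0 mul0r -tofrac0 => /tofrac_inj <-.
  by rewrite rmorph0.
by split=> //; rewrite -?xd -?cd mulKf.
Qed.

Lemma frac_at_nat n : frac_at n%:R n%:R.
Proof. by rewrite -(rmorph_nat (@tofrac _)) -(rmorph_nat ev); apply: frac_at_tofrac. Qed.

Lemma frac_at_sum (I : Type) (r : seq I) (P : pred I) (f : I -> {fraction A}) (g : I -> F) :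
  (forall i, P i -> frac_at (f i) (g i)) ->
  frac_at (\sum_(i <- r | P i) f i) (\sum_(i <- r | P i) g i).
Proof.
move=> h; elim/big_rec2: _ => [|i y x Pi hxy]; first exact: (frac_at_nat 0).
by apply: frac_atD => //; apply: h.
Qed.

Lemma frac_at_prod (I : Type) (r : seq I) (P : pred I) (f : I -> {fraction A}) (g : I -> F) :
  (forall i, P i -> frac_at (f i) (g i)) ->
  frac_at (\prod_(i <- r | P i) f i) (\prod_(i <- r | P i) g i).
Proof.
move=> h; elim/big_rec2: _ => [|i y x Pi hxy]; first exact: (frac_at_nat 1).
by apply: frac_atM => //; apply: h.
Qed.

Lemma frac_atX x c n : frac_at x c -> frac_at (x ^+ n) (c ^+ n).
Proof.
move=> h; elim: n => [|n IH]; first by rewrite !expr0; apply: (frac_at_nat 1).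
by rewrite !exprS; apply: frac_atM.
Qed.

Lemma frac_atN x c : frac_at x c -> frac_at (- x) (- c).
Proof.
move=> [q [d [d0 xd cd]]]; exists (- q), d; split=> //.
  by rewrite tofracN mulNr xd.
by rewrite rmorphN mulNr cd.
Qed.

Lemma frac_at_exprz x c (k : int) : c != 0 -> frac_at x c ->
  frac_at (x ^ k) (c ^ k).
Proof.
move=> c0 h; case: k => n; first exact: frac_atX.
by rewrite NegzE -!exprnN; apply: frac_atV; [rewrite expf_neq0 | apply: frac_atX].
Qed.

Lemma frac_at_det n (M : 'M[{fraction A}]_n) (N : 'M[F]_n) :
  (forall i j, frac_at (M i j) (N i j)) -> frac_at (\det M) (\det N).
Proof.
move=> h; apply: frac_at_sum => sg _; apply: frac_atM.
  by apply: frac_atX; apply: frac_atN; apply: (frac_at_nat 1).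
by apply: frac_at_prod => i _; apply: h.
Qed.

End FractionEval.

Section LaurentEval.
Variables (C : numFieldType) (u z : C).

Definition eval_u : {poly int} -> C := horner_eval u \o map_poly intr.
HB.instance Definition _ := GRing.RMorphism.copy eval_u (horner_eval u \o map_poly intr).
Definition eval_ut : {poly {poly int}} -> C := horner_eval z \o map_poly eval_u.
HB.instance Definition _ := GRing.RMorphism.copy eval_ut (horner_eval z \o map_poly eval_u).

Definition laurent_at : laurent -> C -> Prop := frac_at eval_ut.

Lemma laurent_at_lconst c : laurent_at (lconst c) (eval_u c).
Proof.
have -> : eval_u c = eval_ut c%:P by rewrite /eval_ut /= /horner_eval map_polyC hornerC.
exact: frac_at_tofrac.
Qed.

Lemma laurent_at_uvar : laurent_at uvar u.
Proof.
have := laurent_at_lconst 'X.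
by rewrite /eval_u /= /horner_eval map_polyX hornerX.
Qed.

Lemma laurent_at_tvar : laurent_at tvar z.
Proof.
have e : eval_ut 'X = z by rewrite /eval_ut /= /horner_eval map_polyX hornerX.
by have := frac_at_tofrac eval_ut 'X; rewrite /= e.
Qed.

End LaurentEval.

Lemma laurent_at_cos (R : realType) (P : {poly {poly int}}) (u z : R[i]) : z != 0 ->
  laurent_at u z (eval_at_cos P) (specialize P u).[(z + z^-1) / 2%:R].
Proof.
move=> z0; rewrite /eval_at_cos /specialize /map_poly !horner_poly.
apply: frac_at_sum => i _; apply: frac_atM; first exact: laurent_at_lconst.
apply: frac_atX; apply: frac_atM; last first.
  by apply: frac_atV; [rewrite pnatr_eq0 | apply: frac_at_nat].
apply: frac_atD; first exact: laurent_at_tvar.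
exact/frac_atV/laurent_at_tvar.
Qed.

(** * The adjacency matrix in terms of voltages *)

Section Adjacency.
Variables (VX EX : finType) (X : graph VX EX) (VY EY : choiceType) (Y : graph VY EY).
Variables (a : zaction Y) (a_free : free_action a) (p : graph_map Y X).
Variables (p_quot : quotient_map a p) (s : VX -> VY).
Hypothesis s_lift : forall x, mapV p (s x) = x.
Variables (lft : EX -> EY) (volt : EX -> int).
Hypothesis voltP : is_voltage a p s lft volt.

(** The edge over [f] that starts at [t^k s v] is [t^k] applied to [lft f]; it ends in sheet
    [k + volt f], which has to be sheet [0]. *)
Lemma adjacencyE k v w : adjacency Y (actV a k (s v)) (s w) =
  #|[pred f | [&& org X f == v, term X f == w & - volt f == k]]|.
Proof.
rewrite /adjacency; set F := [pred f | _].
have lft_inj : injective lft.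
  by move=> f g e; have [<- _ _] := voltP f; have [<- _ _] := voltP g; rewrite e.
have act_inj : injective (actE a k).
  by apply: (can_inj (g := actE a (- k))) => e; rewrite -actED addNr actE0.
have actT e : term Y (actE a k e) = actV a k (term Y e).
  by rewrite /term (act_einv a) (act_org a).
have -> : [set e | org Y e = actV a k (s v) /\ term Y e = s w] =
    [set` [fset e in [seq actE a k (lft f) | f <- enum F]]%fset].
  apply/seteqP; split=> e /=; rewrite inE.
    move=> [eo et]; set f := mapE p e; have [fp fo ft] := voltP f.
    have fv : org X f = v by rewrite (map_org p) eo (mapV_act p_quot) s_lift.
    have fw : term X f = w by rewrite map_term et s_lift.
    have eE : e = actE a k (lft f).
      apply: (lift_edge_uniq a_free p_quot); first by rewrite (mapE_act p_quot) fp.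
      by rewrite (act_org a) fo eo fv.
    apply/mapP; exists f => //; rewrite mem_enum inE fv fw !eqxx /=.
    have : actV a (k + volt f) (s w) = s w by rewrite actVD -fw -ft -actT -eE et fw.
    by move=> /a_free /eqP; rewrite addr_eq0 eq_sym.
  move=> /mapP [f]; rewrite mem_enum inE => /and3P[/eqP fv /eqP fw /eqP fk] ->.
  have [fp fo ft] := voltP f.
  by rewrite (act_org a) fo fv actT ft fw -actVD -fk addNr actV0.
rewrite set_fsetK card_fseq undup_id ?size_map -?cardE //.
by rewrite map_inj_uniq ?enum_uniq // => f g /act_inj/lft_inj.
Qed.

Lemma adjacency_entryE v w : adjacency_entry a s v w =
  \sum_(f | (org X f == v) && (term X f == w)) tvar ^ (- volt f).
Proof.
rewrite /adjacency_entry.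
pose A := [fset k in [seq - volt f | f <- enum EX]]%fset.
rewrite (fsbigTE A) => [|k kA]; last first.
  rewrite adjacencyE eq_card0 ?mul0r // => f; rewrite !inE.
  apply: contraNF kA => /and3P[_ _ /eqP <-].
  by rewrite inE; apply/mapP; exists f; rewrite ?mem_enum.
rewrite (eq_bigr (fun k => \sum_(f | (org X f == v) && (term X f == w))
   if - volt f == k then tvar ^ k else 0)); last first.
  move=> k _; rewrite adjacencyE -sum1_card natr_sum mulr_suml -big_mkcondr /=.
  by apply: eq_big => [f|f _]; rewrite ?inE ?andbA ?mul1r.
rewrite exchange_big /=; apply: eq_bigr => f _.
rewrite (bigD1_seq (- volt f)) ?fset_uniq //=; last first.
  by rewrite inE; apply/mapP; exists f; rewrite ?mem_enum.
rewrite eqxx big1 ?addr0 // => k /negPf; by rewrite eq_sym => ->.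
Qed.

Lemma det_Delta_at (R : realType) (u z : R[i]) : z != 0 ->
  laurent_at u z (\det (Delta_mx X a s))
    (\det (weighted_Delta X (volt_weight volt z) u)).
Proof.
move=> z0; apply: frac_at_det => i j; rewrite !mxE.
have at_nat n : laurent_at u z n%:R n%:R by apply: frac_at_nat.
apply: frac_atD; [apply: frac_atD|].
- exact: at_nat.
- apply/frac_atN/frac_atM; first exact: laurent_at_uvar.
  rewrite adjacency_entryE; apply: frac_at_sum => f _.
  exact/frac_at_exprz/laurent_at_tvar.
apply: frac_atM; first exact/frac_atX/laurent_at_uvar.
case: (i == j); rewrite ?mulr1n ?mulr0n; last exact: (at_nat 0%N).
apply: frac_atD; first exact: at_nat.
exact/frac_atN/(at_nat 1%N).
Qed.

(** The hypothesis is an equality in the fraction field. Both sides have a value at [(u, z)], and a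
    fraction has at most one value there. *)
Lemma det_specialize (R : realType) (P : {poly {poly int}}) (u z : R[i]) : z != 0 ->
  \det (Delta_mx X a s) = eval_at_cos P ->
  (specialize P u).[(z + z^-1) / 2%:R] =
  \det (weighted_Delta X (volt_weight volt z) u).
Proof.
move=> z0 Pdet; have := det_Delta_at u z0; rewrite Pdet.
exact/frac_at_uniq/laurent_at_cos.
Qed.

End Adjacency.

(** * Principal square roots *)

Section PrincipalRoot.
Variable R : realType.
Implicit Types z r : R[i].

Lemma cmod_gt0 z : z != 0 -> 0 < cmod z.
Proof.
case: z => x y; rewrite eq_complex /= negb_and => h.
rewrite /cmod /= sqrtr_gt0; case/orP: h => h.
  by rewrite ltr_pwDl ?sqr_ge0 // exprn_even_gt0.
by rewrite ltr_wpDl ?sqr_ge0 // exprn_even_gt0.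
Qed.

Lemma carg_spec z : z != 0 ->
  [/\ cos (carg z) = complex.Re z / cmod z, sin (carg z) = complex.Im z / cmod z
    & if 0 <= complex.Im z then 0 <= carg z <= pi else - pi <= carg z <= 0].
Proof.
move=> z0; have c0 := cmod_gt0 z0; set c := cmod z in c0 *.
have c2 : c ^+ 2 = complex.Re z ^+ 2 + complex.Im z ^+ 2.
  by rewrite sqr_sqrtr // addr_ge0 ?sqr_ge0.
set x := complex.Re z in c2 *; set y := complex.Im z in c2 *.
have t1 : -1 <= x / c <= 1.
  rewrite -ler_norml normrM normfV (gtr0_norm c0) ler_pdivrMr // mul1r.
  by rewrite -sqrtr_sqr ler_wsqrtr // lerDl sqr_ge0.
have [/andP[a0 api] ca] := acos_def t1.
have sa : sin (acos (x / c)) = `|y| / c.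
  rewrite sin_acos // -[RHS]ger0_norm ?divr_ge0 ?(ltW c0) // -sqrtr_sqr.
  congr Num.sqrt; rewrite !expr_div_n -normrX ger0_norm ?sqr_ge0 //.
  have c2n : c ^+ 2 != 0 by rewrite expf_neq0 // gt_eqF.
  by apply: (mulIf c2n); rewrite divfK // mulrBl divfK // mul1r c2; ring.
rewrite /carg -/x -/y -/c; case: (leP 0 y) => y0; split=> //.
- by rewrite sa ger0_norm.
- by rewrite a0 api.
- by rewrite cosN.
- by rewrite sinN sa ltr0_norm // mulNr opprK.
- by rewrite lerN2 api oppr_le0 a0.
Qed.

(** Halving the principal argument puts the root into the closed quadrant selected by the sign of
    the imaginary part. Negative reals, of argument [pi], fall under [0 <= Im z]. *)
Lemma csqrt_spec z : [/\ csqrt z ^+ 2 = z, 0 <= complex.Re (csqrt z)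
  & if 0 <= complex.Im z then 0 <= complex.Im (csqrt z)
    else complex.Im (csqrt z) <= 0].
Proof.
rewrite /csqrt /cpow; have [->|z0] := eqVneq z 0.
  by rewrite invr_eq0 pnatr_eq0 /= expr0n /= lexx.
have c0 := cmod_gt0 z0; have [cb sb hb] := carg_spec z0.
set b := carg z in cb sb hb *; set c := cmod z in c0 cb sb *.
pose e := expR (ln c / 2).
have e0 : 0 < e by apply: expR_gt0.
have e2 : e ^+ 2 = c by rewrite expr2 -expRD -splitr lnK.
have -> : cexp (2%:R^-1 * clog z) = (e * cos (b / 2) +i* (e * sin (b / 2)))%C.
  have -> : 2%:R^-1 * clog z = (ln c / 2 +i* (b / 2))%C.
    have -> : 2%:R^-1 = (2%:R^-1)%:C%C :> R[i] by rewrite fmorphV rmorph_nat.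
    by rewrite /clog -/c -/b; simpc; rewrite ![2%:R^-1 * _]mulrC.
  by rewrite /cexp /= -/e; simpc.
have zr : complex.Re z = c * (cos (b / 2) * cos (b / 2) - sin (b / 2) * sin (b / 2)).
  by rewrite -cosD -splitr cb mulrC divfK // gt_eqF.
have zi : complex.Im z = c * (sin (b / 2) * cos (b / 2) + cos (b / 2) * sin (b / 2)).
  by rewrite -sinD -splitr sb mulrC divfK // gt_eqF.
split=> /=.
- apply/eqP; rewrite eq_complex expr2; simpc; rewrite zr zi -e2 /=.
  by apply/andP; split; apply/eqP; ring.
- rewrite mulr_ge0 ?(ltW e0) // cos_ge0_pihalf //.
  by case: ifP hb => _ /andP[h1 h2]; have := pi_ge0 R; lra.
case: ifP hb => _ /andP[h1 h2].
  rewrite mulr_ge0 ?(ltW e0) // sin_ge0_pi //; have := pi_ge0 R; lra.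
rewrite mulr_ge0_le0 ?(ltW e0) // -oppr_ge0 -sinN sin_ge0_pi //; have := pi_ge0 R; lra.
Qed.

Definition joukowski_inv r : R[i] := r + csqrt (r + 1) * csqrt (r - 1).

(* With [a = sqrt(r+1)], [b = sqrt(r-1)] in a common closed quadrant,
   [r + ab = (a+b)^2/2] and [r - ab = (a-b)^2/2] are mutually inverse and
   [|a-b| <= |a+b|]. *)
Lemma joukowski_invP r (w := joukowski_inv r) :
  [/\ w != 0, r = (w + w^-1) / 2%:R & `|w^-1| <= 1].
Proof.
have [a2 ra ia] := csqrt_spec (r + 1); have [b2 rb ib] := csqrt_spec (r - 1).
rewrite {}/w /joukowski_inv; set a := csqrt _ in a2 ra ia *.
set b := csqrt _ in b2 rb ib *; set w := r + a * b; pose w' := r - a * b.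
have ww' : w * w' = 1.
  have -> : w * w' = r ^+ 2 - a ^+ 2 * b ^+ 2 by rewrite /w /w'; ring.
  by rewrite a2 b2; ring.
have w0 : w != 0 by apply: contra_eq_neq ww' => ->; rewrite mul0r eq_sym oner_neq0.
have wV : w^-1 = w' by apply: (mulfI w0); rewrite divff.
have two0 : 2%:R != 0 :> R[i] by rewrite pnatr_eq0.
have re : r = (a ^+ 2 + b ^+ 2) / 2%:R by rewrite a2 b2; field.
split=> //; first by rewrite wV /w /w'; field.
have wE : w = (a + b) ^+ 2 / 2%:R by rewrite /w {1}re; field.
have w'E : w' = (a - b) ^+ 2 / 2%:R by rewrite /w' {1}re; field.
have le1 : `|w'| <= `|w|.
  rewrite wE w'E normrM [X in _ <= X]normrM ler_wpM2r // !normrX.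
  rewrite ler_pXn2r ?nnegrE // !normc_def lecR.
  apply: ler_wsqrtr.
  (* Both radicands have the imaginary part of [r], hence both roots fall under the same case of the
     branch. *)
  have im1 : complex.Im (r + 1) = complex.Im r by case: (r) => x y /=; rewrite addr0.
  have im2 : complex.Im (r - 1) = complex.Im r by case: (r) => x y /=; rewrite subr0.
  rewrite im1 in ia; rewrite im2 in ib.
  case: (a) (b) ra ia rb ib => [a1 a3] [b1 b3] /= ra ia rb ib.
  have h1 : 0 <= a1 * b1 by rewrite mulr_ge0.
  have h2 : 0 <= a3 * b3.
    by case: ifP ia ib => _ ? ?; [rewrite mulr_ge0 | rewrite mulr_le0].
  nra.
have : `|w^-1| ^+ 2 <= 1.
  by rewrite -(normr1 R[i]) -ww' normrM wV expr2 ler_wpM2r.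
by rewrite -[X in _ <= X](expr1n _ 2) ler_pXn2r ?nnegrE.
Qed.

End PrincipalRoot.

(** * Elementary bounds for finite products near 1 *)

Section ProductEstimates.
Variable K : numFieldType.
Variables (I : Type).
Implicit Types (r : seq I) (a : I -> K).

(** Induction on [(1 + x)(1 - x - S) <= 1 - S]; it takes the place of a bound by the exponential. *)
Lemma prod1D_le r a : (forall i, 0 <= a i) ->
  (\prod_(i <- r) (1 + a i)) * (1 - \sum_(i <- r) a i) <= 1.
Proof.
move=> a0; elim: r => [|i r IH]; first by rewrite !big_nil subr0 mulr1.
rewrite !big_cons; apply: le_trans IH.
set P := \prod_(j <- r) _; set S := \sum_(j <- r) _.
have P0 : 0 <= P by apply: prodr_ge0 => j _; rewrite addr_ge0.
have S0 : 0 <= S by apply: sumr_ge0.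
have -> : (1 + a i) * P * (1 - (a i + S)) =
          P * (1 - S) - P * (a i ^+ 2 + a i * S) by ring.
by rewrite gerBl mulr_ge0 // addr_ge0 // ?exprn_ge0 // mulr_ge0.
Qed.

Lemma norm_prod1B_ge r a : \sum_(i <- r) `|a i| <= 1 ->
  1 - \sum_(i <- r) `|a i| <= `|\prod_(i <- r) (1 - a i)|.
Proof.
elim: r => [|i r IH]; first by rewrite !big_nil subr0 normr1.
rewrite !big_cons => h; set S := \sum_(j <- r) _ in h IH *.
have S0 : 0 <= S by apply: sumr_ge0.
have h1 : S <= 1 by apply: le_trans h; rewrite lerDr.
have h2 : `|a i| <= 1 by apply: le_trans h; rewrite lerDl.
rewrite normrM; apply: (@le_trans _ _ ((1 - `|a i|) * (1 - S))).
  have -> : (1 - `|a i|) * (1 - S) = 1 - (`|a i| + S) + `|a i| * S by ring.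
  by rewrite lerDl mulr_ge0.
apply: ler_pM; rewrite ?subr_ge0 ?IH //.
by rewrite -{1}(normr1 K) lerB_dist.
Qed.

Lemma norm_prod1B_sub1 r a :
  `|\prod_(i <- r) (1 - a i) - 1| <= \prod_(i <- r) (1 + `|a i|) - 1.
Proof.
elim: r => [|i r IH]; first by rewrite !big_nil subrr normr0.
rewrite !big_cons; set P := \prod_(j <- r) (1 - _) in IH *.
set S := \prod_(j <- r) _ in IH *.
have -> : (1 - a i) * P - 1 = (1 - a i) * (P - 1) - a i by ring.
have -> : (1 + `|a i|) * S - 1 = (1 + `|a i|) * (S - 1) + `|a i| by ring.
apply: (le_trans (ler_normB _ _)); rewrite lerD2r normrM.
apply: ler_pM => //; apply: (le_trans (ler_normB _ _)).
by rewrite normr1.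
Qed.

Lemma prod1D_le2 r a : (forall i, 0 <= a i) -> \sum_(i <- r) a i <= 2%:R^-1 ->
  \prod_(i <- r) (1 + a i) <= 1 + 2%:R * \sum_(i <- r) a i.
Proof.
move=> a0 h; have := prod1D_le r a0.
set P := \prod_(j <- r) _; set S := \sum_(j <- r) _ in h *.
have S0 : 0 <= S by apply: sumr_ge0.
have S1 : 0 < 1 - S.
  by rewrite subr_gt0 (le_lt_trans h) // invf_lt1 ?ltr0n // ltr1n.
rewrite -ler_pdivlMr // => /le_trans -> //.
rewrite ler_pdivrMr // -subr_ge0.
have -> : (1 + 2%:R * S) * (1 - S) - 1 = 2%:R * S * (2%:R^-1 - S) by field.
by rewrite mulr_ge0 ?mulr_ge0 ?ler0n // subr_ge0.
Qed.

Lemma norm_prod1B_sub1_half r a : \sum_(i <- r) `|a i| <= 2%:R^-1 ->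
  `|\prod_(i <- r) (1 - a i) - 1| <= 2%:R * \sum_(i <- r) `|a i|.
Proof.
move=> h; apply: (le_trans (norm_prod1B_sub1 _ _)).
by rewrite lerBlDl; apply: prod1D_le2 => // i; rewrite normr_ge0.
Qed.

End ProductEstimates.

(** * Comparison of the determinants with the orbit products *)

Section EdgeDeterminants.
Variables (C : numClosedFieldType) (VX EX : finType) (X : graph VX EX).
Variables (volt : EX -> int) (L : nat).
Hypothesis voltL : forall f, (`|volt f| <= L)%N.

Lemma coef_logder_1subXn (d M k : nat) (lam : C) : (0 < d)%N -> (k < M)%N ->
  (\sum_(j < M) (d%:R * lam ^+ j.+1) *: 'X^(d * j.+1))`_k =
  if (0 < k)%N && (d %| k)%N then d%:R * lam ^+ (k %/ d) else 0.
Proof.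
move=> d0 kM; rewrite coef_sum.
under eq_bigr do rewrite coefZ coefXn.
case: ifP => [/andP[k0 dk]|h]; last first.
  rewrite big1 // => j _; case: eqP => [kE|_]; last by rewrite mulr0.
  by move: h; rewrite kE muln_gt0 d0 dvdn_mulr.
have kd0 : (0 < k %/ d)%N by rewrite divn_gt0 // dvdn_leq.
have jM : ((k %/ d).-1 < M)%N.
  by rewrite prednK // (leq_trans (leq_div _ _)) // ltnW.
rewrite (bigD1 (Ordinal jM)) //= prednK // mulnC divnK // eqxx mulr1 big1 ?addr0 //.
move=> j jn; case: eqP => [kE|_]; last by rewrite mulr0.
case/eqP: jn; apply: val_inj => /=; by rewrite kE mulKn.
Qed.

Lemma norm_prim_root N (z : C) : N.-primitive_root z -> `|z| = 1.
Proof.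
move=> zp; apply/eqP; rewrite -(pexpr_eq1 (prim_order_gt0 zp)) // -normrX.
by rewrite (prim_expr_order zp) normr1.
Qed.

Lemma norm_exprz1 (z : C) (k : int) : `|z| = 1 -> `|z ^ k| = 1.
Proof.
by move=> z1; case: k => n; rewrite ?NegzE -?exprnN ?normfV normrX z1 expr1n ?invr1.
Qed.

Lemma edge_mx_le1 (z : C) i j : `|z| = 1 ->
  `|edge_mx X (volt_weight volt z) i j| <= 1.
Proof.
move=> z1; rewrite mxE normrM norm_exprz1 // mulr1 normr_nat.
by rewrite lern1 leq_b1.
Qed.

(** Both products are values at [u] of polynomials [G] and [F^N] with constant term 1. Up to sign,
    coefficient [k] of their logarithmic derivatives is the sum of the traces of [T_i^k],
    respectively [N] times the number of good words of length [k]; these agree for [0 < k < M]. So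
    [X^M] divides [G - F^N], and the norm at radius [rho] turns this into the factor
    [(|u|/rho)^M]. *)
Lemma det_vs_orbits (O : Type) (len : O -> nat) (Os : seq O) (M N : nat) (z u rho : C) :
  (forall o, 0 < len o)%N ->
  (forall m, (0 < m < M)%N ->
    num_closed X volt m = (\sum_(o <- Os) len o * (len o %| m))%N) ->
  N.-primitive_root z -> (M * L <= N)%N ->
  0 < rho -> `|u| <= rho -> #|EX|%:R * rho <= 1 ->
  \sum_(o <- Os) rho ^+ len o <= 2%:R^-1 ->
  `|\prod_(i < N) \det (1%:M - u *: edge_mx X (volt_weight volt (z ^+ i))) -
    (\prod_(o <- Os) (1 - u ^+ len o)) ^+ N|
    <= (`|u| / rho) ^+ M * ((2%:R ^+ #|EX|) ^+ N + 2%:R ^+ N).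
Proof.
move=> len0 cnt zp MLN r0 ur Er Sr.
have N0 := prim_order_gt0 zp; have z1 := norm_prim_root zp.
have zi1 (i : nat) : `|z ^+ i| = 1 by rewrite normrX z1 expr1n.
pose T (i : 'I_N) := edge_mx X (volt_weight volt (z ^+ i)).
have [lam lamP] := choice (fun i => spectrum (T i)).
pose G : {poly C} := \prod_(i < N) \prod_(j < #|EX|) (1 - lam i j *: 'X^1).
pose F : {poly C} := \prod_(o <- Os) (1 - 1 *: 'X^(len o)).
have Gu : G.[u] = \prod_(i < N) \det (1%:M - u *: T i).
  rewrite horner_prod; apply: eq_bigr => i _; have [-> _ _] := lamP i.
  by rewrite horner_prod; apply: eq_bigr => j _; rewrite !hornerE mulrC.
have Fu : (F ^+ N).[u] = (\prod_(o <- Os) (1 - u ^+ len o)) ^+ N.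
  rewrite horner_exp horner_prod; congr (_ ^+ _); apply: eq_bigr => o _.
  by rewrite scale1r !hornerE.
rewrite -Fu -Gu -hornerN -hornerD.
have lam_le i j : `|lam i j| <= #|EX|%:R.
  have [_ _ /(_ j) [v v0 hv]] := lamP i.
  by apply: eigenvalue_bound v0 hv => k l; apply: edge_mx_le1.
(* Each linear factor has norm at most [1 + #|EX| rho <= 2]. *)
have wG : wnorm rho G <= (2%:R ^+ #|EX|) ^+ N.
  apply: (le_trans (wnorm_prod _ _ (ltW r0))).
  rewrite -[X in _ <= _ ^+ X]card_ord -prodr_const; apply: ler_prod => i _.
  rewrite wnorm_ge0 ?(ltW r0) //=.
  apply: (le_trans (wnorm_prod _ _ (ltW r0))).
  rewrite -[X in _ <= _ ^+ X]card_ord -prodr_const; apply: ler_prod => j _.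
  rewrite wnorm_ge0 ?(ltW r0) //=; apply: (le_trans (wnormB _ _ (ltW r0))).
  rewrite -polyC1 wnormC normr1 wnorm_monomial expr1 -[2%:R]/(1 + 1) lerD2l.
  by apply: le_trans Er; rewrite ler_wpM2r ?(ltW r0).
have wF : wnorm rho (F ^+ N) <= 2%:R ^+ N.
  rewrite -[X in F ^+ X]card_ord -prodr_const.
  apply: (le_trans (wnorm_prod _ _ (ltW r0))); rewrite prodr_const card_ord.
  rewrite lerXn2r ?nnegrE ?wnorm_ge0 ?(ltW r0) ?ler0n //.
  apply: (le_trans (wnorm_prod _ _ (ltW r0))).
  apply: (@le_trans _ _ (\prod_(o <- Os) (1 + rho ^+ len o))).
    apply: ler_prod => o _; rewrite wnorm_ge0 ?(ltW r0) //=.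
    apply: (le_trans (wnormB _ _ (ltW r0))).
    by rewrite -polyC1 wnormC normr1 wnorm_monomial normr1 mul1r.
  apply: (le_trans (prod1D_le2 _ Sr)) => [o|]; first by rewrite exprn_ge0 // ltW.
  by rewrite -[X in _ <= X]/(1 + 1) lerD2l mulrC -ler_pdivlMr ?ltr0n // div1r.
apply: (@le_trans _ _ ((`|u| / rho) ^+ M * wnorm rho (G - F ^+ N))); last first.
  rewrite ler_wpM2l ?exprn_ge0 ?divr_ge0 ?(ltW r0) //.
  by apply: (le_trans (wnormB _ _ (ltW r0))); apply: lerD.
apply: norm_horner_le => //.
have G0 : G`_0 = 1.
  rewrite -horner_coef0 !horner_prod big1 // => i _; rewrite horner_prod big1 // => j _.
  by rewrite !hornerE ?mulr0 ?subr0.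
have F0 : (F ^+ N)`_0 = 1.
  rewrite -horner_coef0 horner_exp horner_prod big1 ?expr1n // => o _.
  by rewrite !hornerE expr0n gtn_eqF // ?mulr0 ?subr0.
have hG : has_logder M G _ := has_logder_prod (index_enum _) (P := xpredT) (fun i _ =>
   has_logder_prod (index_enum _) (P := xpredT)
     (fun j _ => has_logder_1subXn M (lam i j) (ltn0Sn 0))).
have hF : has_logder M (F ^+ N) _ := has_logderX N (has_logder_prod Os (P := xpredT)
   (fun o _ => has_logder_1subXn M 1 (len0 o))).
apply: has_logder_inj G0 F0 _ _ hG hF => [|k kM].
  rewrite coef_sum big1 // => i _; rewrite coef_sum big1 // => j _.
  rewrite coef_sum big1 // => l _; by rewrite coefZ coefXn mulr0.
rewrite coef_sum coefMn coef_sum.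
under eq_bigr => i _.
  rewrite coef_sum; under eq_bigr => j _ do rewrite coef_logder_1subXn // dvd1n divn1 mul1r andbT.
  over.
under [in RHS]eq_bigr => o _ do rewrite coef_logder_1subXn // expr1n mulr1.
have [->|k0] := posnP k; first by rewrite !big1 ?mul0rn // => i _; rewrite big1.
transitivity (\sum_(i < N) \tr (T i ^+ k)).
  by apply: eq_bigr => i _; have [_ -> _] := lamP i.
(* [k < M] makes the inequality strict unless [L = 0], where [N > 0] is used instead. *)
have kL : (k * L < N)%N.
  have [L0|L0] := posnP L; first by rewrite L0 muln0.
  by apply: leq_trans MLN; rewrite ltn_pmul2r.
rewrite (sum_trace X voltL zp k0 kL) cnt ?k0 // mulnC natrM mulr_natr natr_sum.
congr (_ *+ _); apply: eq_bigr => o _ /=.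
by case: (_ %| _)%N; rewrite ?muln1 ?muln0.
Qed.

End EdgeDeterminants.

Section LengthSums.
Variables (K : numFieldType) (O : eqType) (len : O -> nat) (b : nat).

Lemma geometric_tail (q : K) (m n : nat) : 0 <= q -> q <= 2%:R^-1 ->
  \sum_(m <= d < n) q ^+ d <= 2%:R * q ^+ m.
Proof.
move=> q0 q2; have [nm|mn] := leqP n m.
  by rewrite big_geq // mulr_ge0 ?exprn_ge0.
rewrite -{1}[m]add0n big_addn big_mkord.
under eq_bigr do rewrite exprD.
rewrite -mulr_suml ler_wpM2r ?exprn_ge0 //.
have := subrX1 q (n - m); move: (n - m)%N => k; set S := \sum_(i < k) _ => h.
have S0 : 0 <= S by apply: sumr_ge0 => i _; rewrite exprn_ge0.
have h1 : S * (1 - q) <= 1.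
  have -> : S * (1 - q) = 1 - q ^+ k by rewrite -[q ^+ k](subrK 1) h; ring.
  by rewrite gerBl exprn_ge0.
have h2 : S * 2%:R^-1 <= S * (1 - q).
  rewrite ler_wpM2l // lerBrDl -lerBrDr; apply: (le_trans q2).
  have e : 2%:R^-1 + 2%:R^-1 = 1 :> K by field.
  by rewrite lerBrDr e.
by have := le_trans h2 h1; rewrite ler_pdivrMr ?ltr0n // mul1r.
Qed.

(** Grouping by length gives a geometric series of ratio [b x], because at most [b^d] terms have
    length [d]. *)
Lemma sum_len_le (x : K) (s : seq O) (m : nat) :
  (forall d, (m <= d)%N -> (count (fun o => len o == d) s <= b ^ d)%N) ->
  0 <= x -> b%:R * x <= 4%:R^-1 ->
  \sum_(o <- s | (m <= len o)%N) x ^+ len o <= 2%:R * (b%:R * x) ^+ m.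
Proof.
move=> cnt x0 bx; set q := b%:R * x in bx *.
have q0 : 0 <= q by rewrite mulr_ge0.
pose n := (\max_(o <- s) len o).+1.
have le_n o : o \in s -> (len o < n)%N by move=> os; rewrite ltnS leq_bigmax_seq.
apply: (@le_trans _ _ (\sum_(m <= d < n) q ^+ d)); last first.
  by apply: geometric_tail => //; apply: (le_trans bx); rewrite lef_pV2 ?posrE ?ltr0n // ler_nat.
rewrite big_seq_cond.
rewrite (eq_bigr (fun o => \sum_(m <= d < n) (len o == d)%:R * x ^+ d)); last first.
  move=> o /andP[os mo].
  rewrite (bigD1_seq (len o)) ?mem_index_iota ?mo ?le_n ?iota_uniq //= eqxx mul1r.
  by rewrite big1 ?addr0 // => d /negPf; rewrite eq_sym => ->; rewrite mul0r.
rewrite exchange_big /=; rewrite !(big_nat _ _ m n); apply: ler_sum => d /andP[md _].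
rewrite -mulr_suml exprMn ler_wpM2r ?exprn_ge0 // -natr_sum -natrX ler_nat.
apply: leq_trans (cnt d md); rewrite -big_seq_cond -sum1_count [X in (_ <= X)%N]big_mkcond /=.
rewrite [X in (X <= _)%N]big_mkcond /=; apply: leq_sum => o _.
by case: eqP => // _; case: ifP.
Qed.

End LengthSums.

(** * Recovering a limit from its powers *)

Section PowerLimits.
Variable K : numFieldType.
(** An Archimedean property that a general [numFieldType] may fail; [complex_expr_small] supplies it
    for [R[i]]. *)
Hypothesis expr_small : forall q e : K, 0 <= q -> q < 1 -> 0 < e ->
  exists n0, forall n, (n0 <= n)%N -> q ^+ n < e.

Lemma cvgM_seq (f g : nat -> K) (x y : K) : f @ \oo --> x -> g @ \oo --> y ->
  f n * g n @[n --> \oo] --> x * y.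
Proof. by move=> hf hg; apply: cvgM. Qed.

Lemma cvgV_seq (f : nat -> K) : f @ \oo --> (1 : K) -> (f n)^-1 @[n --> \oo] --> (1 : K).
Proof. by move=> hf; rewrite -[1]invr1; apply: cvgV => //; apply: oner_neq0. Qed.

Lemma eq_cvg_seq (f g : nat -> K) (x : K) : f =1 g -> f @ \oo --> x -> g @ \oo --> x.
Proof. by move=> /funext ->. Qed.

Lemma cvg_geometric_bound (f : nat -> K) (l q c : K) :
  0 <= q -> q < 1 -> 0 <= c -> (forall n, `|f n - l| <= c * q ^+ n) ->
  f @ \oo --> l.
Proof.
move=> q0 q1 c0 hf; apply/cvgrPdist_lt => e e0.
have c1 : 0 < 1 + c by rewrite ltr_wpDr.
have [n0 hn] := expr_small q0 q1 (divr_gt0 e0 c1).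
exists n0 => // n /= nn; rewrite distrC; apply: (le_lt_trans (hf n)).
have := hn n nn; rewrite ltr_pdivlMr // => h; apply: le_lt_trans h.
by rewrite mulrC ler_wpM2l ?exprn_ge0 // lerDr.
Qed.

(** [y] is the quotient of the two powers as soon as the lower one is within distance less than 1 of
    1, hence nonzero. *)
Lemma cvg_ratio_of_powers (y : nat -> K) (N : nat -> nat) :
  y M ^+ N M @[M --> \oo] --> (1 : K) -> y M ^+ (N M).+1 @[M --> \oo] --> (1 : K) ->
  y @ \oo --> (1 : K).
Proof.
move=> h0 h1.
have h : (fun M => y M ^+ (N M).+1 / y M ^+ N M) @ \oo --> (1 : K).
  by have := cvgM_seq h1 (cvgV_seq h0); rewrite mulr1.
apply/cvgrPdist_lt => e e0.
have /cvgrPdist_lt /(_ e e0) := h; have /cvgrPdist_lt /(_ 1 ltr01) := h0.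
apply: filterS2 => M hM; rewrite /= exprS mulfK //; apply: contraTneq hM => ->.
by rewrite subr0 normr1 ltxx.
Qed.

Lemma cvg_prod1 (I : Type) (r : seq I) (f : I -> nat -> K) :
  (forall i, f i @ \oo --> (1 : K)) -> \prod_(i <- r) f i M @[M --> \oo] --> (1 : K).
Proof.
move=> h; elim: r => [|i r IH].
  by under eq_fun do rewrite big_nil; apply: cvg_cst.
under eq_fun do rewrite big_cons.
by have := cvgM_seq (h i) IH; rewrite mulr1.
Qed.

Variables (c : K) (F G : nat -> K) (n : nat) (v : 'I_n -> K) (L : nat) (kap B : K).
Hypotheses (c_neq0 : c != 0) (v_lt1 : forall i, `|v i| < 1) (L_gt0 : (0 < L)%N).
Hypotheses (kap_ge0 : 0 <= kap) (B_ge0 : 0 <= B) (kapB : kap * (2%:R * B) ^+ L < 1).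
Hypothesis hG : forall N, (0 < N)%N -> G N = c ^+ N * \prod_i (1 - v i ^+ N) ^+ 2.
Hypothesis hF : forall M, 2%:R^-1 <= `|F M|.
Hypothesis hGF : forall M N, (0 < N)%N -> (M * L <= N)%N ->
  `|G N - F M ^+ N| <= kap ^+ M * B ^+ N.

(** With [N = M L + j], dividing [hGF] by [F M ^+ N] costs at most [2^N] because [|F M| >= 1/2]. The
    relative error is thus at most [(kap (2 B)^L)^M (2 B)^j], which tends to 0 for fixed [j], while
    the products over [v] tend to 1. *)
Lemma cvg_of_power_approx : F @ \oo --> c.
Proof.
have F0 M : F M != 0.
  by rewrite -normr_gt0 (lt_le_trans _ (hF M)) // invr_gt0 ltr0n.
have FV M : `|(F M)^-1| <= 2%:R.
  rewrite normfV -[2%:R]invrK lef_pV2 ?posrE ?normr_gt0 ?F0 //.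
  by rewrite invr_gt0 ltr0n.
pose kp N := \prod_i (1 - v i ^+ N) ^+ 2.
have vN i N : (0 < N)%N -> 1 - v i ^+ N != 0.
  move=> N0; rewrite subr_eq0 eq_sym; apply: contraTneq (v_lt1 i) => h.
  have : `|v i| ^+ N = 1 by rewrite -normrX h normr1.
  by move=> /eqP; rewrite pexpr_eq1 // => /eqP ->; rewrite ltxx.
have kp0 N : (0 < N)%N -> kp N != 0.
  by move=> N0; apply/prodf_neq0 => i _; rewrite expf_neq0 ?vN.
pose y M := c / F M.
have lim_g j : (0 < j)%N -> G (M * L + j)%N / F M ^+ (M * L + j) @[M --> \oo] --> (1 : K).
  move=> j0; pose q := kap * (2%:R * B) ^+ L.
  apply: (@cvg_geometric_bound _ 1 q ((2%:R * B) ^+ j)) => //.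
  - by rewrite mulr_ge0 ?exprn_ge0 ?mulr_ge0.
  - by rewrite exprn_ge0 ?mulr_ge0.
  move=> M; set N := (M * L + j)%N.
  have N0 : (0 < N)%N by rewrite addn_gt0 j0 orbT.
  have -> : G N / F M ^+ N - 1 = (G N - F M ^+ N) * (F M)^-1 ^+ N.
    by rewrite mulrBl exprVn divff // expf_neq0.
  rewrite normrM normrX; apply: (@le_trans _ _ (kap ^+ M * B ^+ N * 2%:R ^+ N)).
    apply: ler_pM => //; first by rewrite exprn_ge0.
      by apply: hGF => //; rewrite leq_addr.
    by apply: lerXn2r; rewrite ?nnegrE.
  rewrite -mulrA -exprMn [B * _]mulrC /q; move: (2%:R * B) => D.
  have -> : D ^+ N = (D ^+ L) ^+ M * D ^+ j by rewrite /N exprD mulnC exprM.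
  by rewrite [(kap * _) ^+ M]exprMn [X in _ <= X]mulrC mulrA.
have lim_k j : (0 < j)%N -> kp (M * L + j)%N @[M --> \oo] --> (1 : K).
  move=> j0; apply: cvg_prod1 => i.
  have h : 1 - v i ^+ (M * L + j) @[M --> \oo] --> (1 : K).
    apply: (@cvg_geometric_bound _ 1 `|v i| 1) => // M.
    rewrite addrC addKr normrN normrX mul1r.
    have ML : (M <= M * L + j)%N by rewrite (leq_trans (leq_pmulr M L_gt0)) ?leq_addr.
    by rewrite -(subnKC ML) exprD ler_piMr ?exprn_ge0 // exprn_ile1 // ltW.
  by have := cvgM_seq h h; rewrite mulr1; under [X in X @ _]eq_fun do rewrite -expr2.
have lim_y j : (0 < j)%N -> y M ^+ (M * L + j) @[M --> \oo] --> (1 : K).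
  move=> j0; have := cvgM_seq (lim_g j j0) (cvgV_seq (lim_k j j0)).
  rewrite mulr1; apply: eq_cvg_seq => M /=.
  have N0 : (0 < M * L + j)%N by rewrite addn_gt0 j0 orbT.
  by rewrite hG // -/(kp _) mulrAC mulfK ?kp0 // /y expr_div_n.
have ly : y @ \oo --> (1 : K).
  apply: (cvg_ratio_of_powers (N := fun M => (M * L + 1)%N)); first exact: lim_y.
  apply: eq_cvg_seq (lim_y 2 isT) => M.
  by rewrite addn1 addn2.
have hc : (fun=> c) @ \oo --> c by apply: cvg_cst.
have := cvgM_seq hc (cvgV_seq ly); rewrite mulr1.
apply: eq_cvg_seq => M /=.
by rewrite /y invf_div mulrCA divff ?mulr1.
Qed.

End PowerLimits.

Section ComplexPowers.
Variable R : realType.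
Local Notation C := (R[i]).

(** The comparisons with [0] force [q] and [e] to be real, so the real geometric limit applies. *)
Lemma complex_expr_small (q e : C) : 0 <= q -> q < 1 -> 0 < e ->
  exists n0, forall n, (n0 <= n)%N -> q ^+ n < e.
Proof.
move=> q0 q1 e0.
have qE : q = (complex.Re q)%:C%C by rewrite RRe_real // ger0_real.
have eE : e = (complex.Re e)%:C%C by rewrite RRe_real // gtr0_real.
move: q0 q1 e0; rewrite qE eE -[0]/((0 : R)%:C%C) -[1]/((1 : R)%:C%C) lecR !ltcR.
move: (complex.Re q) (complex.Re e) => x y x0 x1 y0.
have : `|x| < 1 by rewrite ger0_norm.
move=> /cvg_expr /cvgrPdist_lt /(_ y y0) [n0 _ h]; exists n0 => n nn.
have := h n nn; rewrite /= sub0r normrN normrX ger0_norm // => hx.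
by rewrite -rmorphXn ltcR.
Qed.

End ComplexPowers.

(** * Convergence *)

Section UnorderedProducts.
Variables (R : realType) (I : choiceType) (D : set I).

Lemma finite_subsets_proper : ProperFilter (finite_subsets D).
Proof.
apply: filter_from_proper; last by move=> A AD; exists A; split.
apply: filter_from_filter; first by exists fset0 => x.
move=> A A' AD A'D; exists (A `|` A')%fset.
  by move=> x /=; rewrite inE => /orP[/AD|/A'D].
move=> B [h BD]; split; split=> //; apply: fsubset_trans h.
  exact: fsubsetUl.
exact: fsubsetUr.
Qed.

Lemma cvg_partial_prod (f : I -> R[i]) (l : R[i]) :
  (forall e : R[i], 0 < e -> exists2 A : {fset I}, [set` A] `<=` D &
     forall B : {fset I}, (A `<=` B)%fset -> [set` B] `<=` D ->
       `|l - partial_prod f B| < e) ->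
  (partial_prod f : {fset I} -> R[i]^o) @ finite_subsets D --> (l : R[i]^o).
Proof.
move=> h; have pF := finite_subsets_proper.
apply/cvgrPdist_lt => e e0; have [A AD hA] := h e e0.
by exists A => // B [AB BD] /=; apply: hA.
Qed.

End UnorderedProducts.

(** Take the least modulus of the nonzero roots; [0] itself may be a root. *)
Lemma poly_nonzero_near0 (R : realType) (q : {poly int}) : q != 0 ->
  exists2 d : R, 0 < d &
    forall u : R[i], 0 < `|u| -> `|u| < d%:C%C -> eval_u u q != 0.
Proof.
move=> q0; set p : {poly R[i]} := map_poly intr q.
have p0 : p != 0.
  by rewrite map_poly_eq0_id0 ?q0 // intr_eq0 lead_coef_eq0.
have [rs pE] := closed_field_poly_normal p.
have [d d0 hd] : exists2 d : R, 0 < d & forall r, r \in rs -> r != 0 -> d%:C%C <= `|r|.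
  elim: rs {pE} => [|r rs [d d0 hd]]; first by exists 1.
  have [->|r0] := eqVneq r 0.
    by exists d => // r'; rewrite inE => /orP[/eqP ->|/hd //]; rewrite eqxx.
  have rE : `|r| = (complex.Re `|r|)%:C%C by rewrite RRe_real // normr_real.
  exists (Num.min d (complex.Re `|r|)) => [|r'].
    rewrite lt_min d0 /= -ltcR -rE -[0%:C%C]/(0 : R[i]) normr_gt0 //.
  rewrite inE => /orP[/eqP -> _|r'rs r'0]; first by rewrite rE lecR ge_min lexx orbT.
  by apply: le_trans (hd _ r'rs r'0); rewrite lecR ge_min lexx.
exists d => // u u0 ud; rewrite /eval_u /= /horner_eval -/p pE hornerZ.
rewrite mulf_neq0 ?lead_coef_eq0 // horner_prod prodf_seq_neq0.
apply/allP => r rrs /=; rewrite !hornerE subr_eq0; apply: contraTneq ud => ur.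
rewrite -real_leNgt ?normr_real ?complex_real //.
by rewrite ur hd // -ur -normr_gt0.
Qed.

Lemma joukowski_factor (C : numFieldType) (w z : C) : w != 0 -> z != 0 ->
  (w + w^-1) / 2%:R - (z + z^-1) / 2%:R =
  w / 2%:R * ((1 - z * w^-1) * (1 - z^-1 * w^-1)).
Proof. by move=> w0 z0; field; rewrite w0 z0. Qed.

(** Merges the two terms of the bound in [det_vs_orbits] into the single power [B^N] of
    [cvg_of_power_approx]. *)
Lemma exprD_superadditive (K : numDomainType) (x y : K) N : 0 <= x -> 0 <= y ->
  (0 < N)%N -> x ^+ N + y ^+ N <= (x + y) ^+ N.
Proof.
move=> x0 y0; case: N => // N _; elim: N => // N IH.
rewrite [X in _ <= X]exprS; apply: (@le_trans _ _ ((x + y) * (x ^+ N.+1 + y ^+ N.+1))).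
  have -> : (x + y) * (x ^+ N.+1 + y ^+ N.+1) =
    x ^+ N.+2 + y ^+ N.+2 + (y * x ^+ N.+1 + x * y ^+ N.+1) by rewrite !exprS; ring.
  by rewrite lerDl addr_ge0 // mulr_ge0 // exprn_ge0.
by rewrite ler_wpM2l ?addr_ge0.
Qed.

(** * Products over the primitive orbits *)

Section OrbitProducts.
Variables (VX EX : finType) (X : graph VX EX) (VY EY : choiceType) (Y : graph VY EY).
Variables (a : zaction Y) (a_free : free_action a) (p : graph_map Y X).
Variables (p_quot : quotient_map a p) (s : VX -> VY).
Hypothesis s_lift : forall x, mapV p (s x) = x.
Variables (lft : EX -> EY) (volt : EX -> int).
Hypothesis voltP : is_voltage a p s lft volt.
Local Notation O := (set (set (VY * seq EY))).
Implicit Types (o : O) (t : seq O).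

(* Positive also on the sets that are not primitive orbits. *)
Definition plen o := maxn 1 (orbit_len o).

Lemma plen_gt0 o : (0 < plen o)%N. Proof. by rewrite leq_max. Qed.

Lemma plenE o : primitive_orbits a o -> plen o = orbit_len o.
Proof.
move=> /(primitive_orbit_len a_free p_quot s_lift voltP) [h _].
exact/maxn_idPr.
Qed.

(** The stabilizer has one element, so the exponent is 1 and the claim is [exp (log z) = z]; a zero
    base is covered by the convention in [cpow]. *)
Lemma zeta_orbit_factorE (R : realType) (u : R[i]) o : primitive_orbits a o ->
  zeta_orbit_factor a u o = 1 - u ^+ plen o.
Proof.
move=> ho; have [_ st] := primitive_orbit_len a_free p_quot s_lift voltP ho.
rewrite plenE // /zeta_orbit_factor /zeta_factor st fset_set1 cardfs1 invr1.
rewrite -/(orbit_len o) /cpow; case: eqVneq => [->|z0]; first by rewrite oner_eq0.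
rewrite mul1r; set z := 1 - _ in z0 *; rewrite /cexp /clog /=.
have c0 := cmod_gt0 z0; have [cb sb _] := carg_spec z0.
rewrite lnK ?posrE // cb sb; simpc.
by case: (z) c0 => x y /= c0; rewrite ![cmod _ * _]mulrC !divfK // gt_eqF.
Qed.

Lemma orbit_lists : exists Os : nat -> seq O, forall M,
  [/\ uniq (Os M), forall o, o \in Os M <-> primitive_orbits a o /\ (plen o < M)%N
    & forall m, (0 < m < M)%N ->
      num_closed X volt m = (\sum_(o <- Os M) plen o * (plen o %| m))%N].
Proof.
have [Os hOs] := choice (orbit_counting a_free p_quot s_lift voltP).
exists Os => M; have [h1 h2 h3] := hOs M; split=> // [o|m mM].
  by split=> [/h2 [ho lo]|[ho lo]]; [rewrite plenE | apply/h2; rewrite -plenE].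
rewrite h3 //; apply: eq_big_seq => o /h2 [ho _]; by rewrite plenE.
Qed.

(** An orbit of length [d] accounts for [d >= 1] of the good words of length [d]. *)
Lemma count_plen t d : uniq t -> (forall o, o \in t -> primitive_orbits a o) ->
  (0 < d)%N -> (count (fun o => plen o == d) t <= #|EX| ^ d)%N.
Proof.
move=> tu tp d0; have [Os hOs] := orbit_lists.
have [h1 h2 h3] := hOs d.+1.
have nc : (num_closed X volt d <= #|EX| ^ d)%N.
  by rewrite -card_tuple max_card.
apply: leq_trans nc; rewrite h3 ?d0 //=.
apply: (@leq_trans (count (fun o => plen o == d) (Os d.+1))).
  rewrite -!size_filter; apply: uniq_leq_size; first exact: filter_uniq.
  move=> o; rewrite !mem_filter => /andP[/eqP od ot]; rewrite od eqxx /=.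
  by apply/h2; split; [apply: tp | rewrite od].
rewrite -sum1_count big_mkcond /=; apply: leq_sum => o _.
by case: eqP => // ->; rewrite dvdnn muln1.
Qed.

Lemma sum_plen_le (K : numFieldType) (x : K) t m : uniq t ->
  (forall o, o \in t -> primitive_orbits a o /\ (m <= plen o)%N) -> (0 < m)%N ->
  0 <= x -> #|EX|%:R * x <= 4%:R^-1 ->
  \sum_(o <- t) x ^+ plen o <= 2%:R * (#|EX|%:R * x) ^+ m.
Proof.
move=> tu tp m0 x0 bx; rewrite big_seq.
rewrite (eq_bigl (fun o => (o \in t) && (m <= plen o)%N)); last first.
  by move=> o; case: (boolP (o \in t)) => // /tp [_ ->].
rewrite -big_seq_cond; apply: sum_len_le => // d md; apply: count_plen => //.
  by move=> o /tp [].
exact: leq_trans m0 md.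
Qed.

(** Here is the origin of [1/4]: from length 1 on, the tail estimate gives [2 * (1/4)]. *)
Lemma sum_plen_half (K : numFieldType) (x : K) t :
  uniq t -> (forall o, o \in t -> primitive_orbits a o) ->
  0 <= x -> #|EX|%:R * x <= 4%:R^-1 -> \sum_(o <- t) x ^+ plen o <= 2%:R^-1.
Proof.
move=> tu tp x0 bx.
apply: (le_trans (sum_plen_le (m := 1) tu _ _ x0 bx)) => //.
  by move=> o /tp ho; split=> //; apply: plen_gt0.
have -> : 2%:R^-1 = 2%:R * 4%:R^-1 :> K by field.
by rewrite expr1 ler_wpM2l.
Qed.

(* The orbits of length at least [M] multiply the product over the shorter ones
   by a factor within [4 (#|EX| |u|)^M] of [1]. *)
Lemma zeta_partial_prods_cvg (R : realType) (Os : nat -> seq O) (u c : R[i]) :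
  (forall M, uniq (Os M) /\
    forall o, o \in Os M <-> primitive_orbits a o /\ (plen o < M)%N) ->
  #|EX|%:R * `|u| <= 4%:R^-1 ->
  (forall e, 0 < e -> exists M0, forall M, (M0 <= M)%N ->
     `|c - \prod_(o <- Os M) (1 - u ^+ plen o)| < e) ->
  zeta_partial_prods a u --> (c : R[i]^o).
Proof.
move=> hOs bu lF; apply: cvg_partial_prod => e e0.
set q := #|EX|%:R * `|u| in bu.
have q0 : 0 <= q by rewrite mulr_ge0.
have q1 : q < 1 by apply: (le_lt_trans bu); rewrite invf_lt1 ?ltr0n // ltr1n.
have e2 : 0 < e / 2%:R by rewrite divr_gt0.
have [M1 hM1] := lF _ e2.
(* The constant is [8 = 2 * 4]: with [|F| <= 2] and [|P2 - 1| <= 4 q^M], the tail contributes at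
   most [e / 2]. *)
have [M2 hM2] := complex_expr_small q0 q1 (divr_gt0 e2 (ltr0n _ 8)).
(* The successor ensures [M > 0], hence [q^M <= q <= 1/4]. *)
pose M := (maxn M1 M2).+1.
have [ou oP] := hOs M.
exists [fset o in Os M]%fset; first by move=> o /=; rewrite inE => /oP [].
move=> B AB BD; rewrite /partial_prod.
have pB o : o \in enum_fset B -> primitive_orbits a o by move=> oB; apply: BD.
rewrite (eq_big_seq (fun o => 1 - u ^+ plen o)); last first.
  by move=> o /pB ho; rewrite zeta_orbit_factorE.
rewrite (bigID (mem (Os M))) /= -[X in X * _]big_filter -[X in _ * X]big_filter.
set B2 := [seq _ <- _ | _ \notin _].
have -> : \prod_(o <- [seq o <- B | o \in Os M]) (1 - u ^+ plen o) =
          \prod_(o <- Os M) (1 - u ^+ plen o).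
  apply: perm_big; apply: uniq_perm => //; first by rewrite filter_uniq ?fset_uniq.
  move=> o; rewrite mem_filter; case: (boolP (o \in Os M)) => //= oM.
  by apply: (fsubsetP AB); rewrite inE.
set F := \prod_(o <- Os M) _; set P2 := \prod_(o <- B2) _.
have normX o : `|u ^+ plen o| = `|u| ^+ plen o by rewrite normrX.
have F2 : `|F| <= 2%:R.
  have h : \sum_(o <- Os M) `|u ^+ plen o| <= 2%:R^-1.
    under eq_bigr do rewrite normX.
    by apply: sum_plen_half => // o /oP [].
  have := norm_prod1B_sub1_half h; rewrite -/F => h1.
  rewrite -[F](subrK 1) (le_trans (ler_normD _ _)) // normr1 -[2%:R]/(1 + 1) lerD2r.
  apply: (le_trans h1); apply: le_trans (ler_wpM2l _ h) _ => //.
  by rewrite divff // pnatr_eq0.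
have sB2 : \sum_(o <- B2) `|u ^+ plen o| <= 2%:R * q ^+ M.
  under eq_bigr do rewrite normX.
  apply: sum_plen_le => //.
    by rewrite filter_uniq ?fset_uniq.
  move=> o; rewrite mem_filter => /andP[oM oB]; split; first exact: pB.
  rewrite leqNgt; apply: contra oM => lo; apply/oP; split=> //; exact: pB.
have qM : q ^+ M <= 4%:R^-1.
  apply: le_trans bu; rewrite /M exprS ler_piMr // exprn_ile1 // ltW //.
have P21 : `|P2 - 1| <= 4%:R * q ^+ M.
  have h : \sum_(o <- B2) `|u ^+ plen o| <= 2%:R^-1.
    apply: (le_trans sB2); have -> : 2%:R^-1 = 2%:R * 4%:R^-1 :> R[i] by field.
    by rewrite ler_wpM2l.
  apply: (le_trans (norm_prod1B_sub1_half h)).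
  have -> : 4%:R * q ^+ M = 2%:R * (2%:R * q ^+ M) by ring.
  by rewrite ler_wpM2l.
have -> : c - F * P2 = (c - F) - F * (P2 - 1) by ring.
apply: (le_lt_trans (ler_normB _ _)); rewrite [e]splitr; apply: ltr_leD.
  by apply: hM1; rewrite /= /M leqW // leq_maxl.
rewrite normrM; apply: (le_trans (ler_pM _ _ F2 P21)) => //.
have := ltW (hM2 M _); rewrite ler_pdivlMr ?ltr0n // => h.
have -> : 2%:R * (4%:R * q ^+ M) = q ^+ M * 8%:R by ring.
by apply: h; rewrite /M leqW // leq_maxr.
Qed.

Lemma volt_weightV (C : numClosedFieldType) (z : C) f : z != 0 ->
  volt_weight volt z f * volt_weight volt z (einv X f) = 1.
Proof.
move=> z0; rewrite /volt_weight (volt_einv a_free p_quot voltP) -expfzDr //.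
by rewrite subrr expr0z.
Qed.

Lemma det_edge_neq0 (C : numClosedFieldType) (z u : C) : `|z| = 1 ->
  #|EX|%:R * `|u| < 1 -> \det (1%:M - u *: edge_mx X (volt_weight volt z)) != 0.
Proof.
move=> z1 u1; have [lam [-> _ hv]] := spectrum (edge_mx X (volt_weight volt z)).
apply/prodf_neq0 => i _; have [v v0 vA] := hv i.
have li := eigenvalue_bound (fun i j => edge_mx_le1 X volt i j z1) v0 vA.
rewrite subr_eq0 eq_sym; apply: contraTneq u1 => h.
have : `|u * lam i| <= #|EX|%:R * `|u| by rewrite normrM mulrC ler_wpM2r.
by rewrite h normr1 => h1; rewrite real_ltNge ?realM ?normr_real ?realn // h1.
Qed.

Lemma det_edge_bass (C : numClosedFieldType) (z u : C) : z != 0 ->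
  1 - u ^+ 2 != 0 ->
  \det (1%:M - u *: edge_mx X (volt_weight volt z)) =
  (1 - u ^+ 2) ^ (- euler_char X) * \det (weighted_Delta X (volt_weight volt z) u).
Proof.
move=> z0 u2; have := bass_identity (fun f => volt_weightV f z0) u2.
set q := 1 - u ^+ 2 in u2 *; rewrite /euler_char opprB expfzDr // -exprnN => h.
have qV : q ^+ #|VX| != 0 by rewrite expf_neq0.
by apply: (mulIf qV); rewrite h -!exprnP mulrAC divfK.
Qed.

End OrbitProducts.

(** * Choice of the radius and conclusion *)

Theorem theorem2p2 (R : realType)
    (VX EX : finType) (X : graph VX EX)
    (VY EY : choiceType) (Y : graph VY EY)
    (a : zaction Y) (a_free : free_action a)
    (p : graph_map Y X) (p_quot : quotient_map a p)
    (s : VX -> VY) (s_lift : forall x, mapV p (s x) = x)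
    (P : {poly {poly int}})
    (P_det : \det (Delta_mx X a s) = eval_at_cos P)
    (n : nat) (n_deg : n = (size P).-1) :
  exists rho : R, 0 < rho /\
  exists (alpha : R[i] -> R[i]) (r : 'I_n -> R[i] -> R[i]),
  forall u : R[i], 0 < `|u| -> `|u| < rho%:C%C ->
    [/\ alpha u != 0,
        specialize P u = alpha u *: \prod_(i < n) ((r i u)%:P - 'X),
        cvg (zeta_partial_prods a u)
      & L2zeta_inv a u =
        (1 - u ^+ 2) ^ (- euler_char X) * (alpha u / 2%:R ^+ n) *
        \prod_(i < n) (r i u + csqrt (r i u + 1) * csqrt (r i u - 1))].
Proof.
have [lft [volt voltP]] := voltage_exists p_quot s_lift.
(* The successor keeps [L] positive when all voltages vanish, so that [M L] grows with [M]. *)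
pose L := (\max_f `|volt f|%N).+1.
have voltL f : (`|volt f| <= L)%N by rewrite leqW // (leq_bigmax f).
have detP (u z : R[i]) : z != 0 -> (specialize P u).[(z + z^-1) / 2%:R] =
    \det (weighted_Delta X (volt_weight volt z) u).
  by move=> z0; apply: (det_specialize a_free p_quot s_lift voltP).
(* At [u = 0] the matrix is the identity, so [P] is not zero. For small nonzero [u] its leading
   coefficient then survives specialization, and the degree stays [n]. *)
have lcP : lead_coef P != 0.
  rewrite lead_coef_eq0; apply/eqP => P0; have := detP 0 1 (oner_neq0 _).
  rewrite P0 /specialize map_poly0 horner0 /weighted_Delta scale0r subr0 expr0n /=.
  by rewrite scale0r addr0 det1 => /eqP; rewrite eq_sym oner_eq0.
have [del del0 hdel] := poly_nonzero_near0 R lcP.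
(* [rho0] gives [b rho0 <= 1/4]; [b.+1] covers the case without edges. In [B0], [2^b] and [2] are
   the norms of an edge determinant and of an orbit product. [rho1] is such that [|u| < rho1] means
   [(|u|/rho0) (2 B0)^L < 1]. *)
pose b := #|EX|; pose rho0 : R := ((4 * b.+1)%N)%:R^-1.
pose B0 : R := 2%:R ^+ b + 2%:R; pose rho1 := rho0 / (2%:R * B0) ^+ L.
have rho0_gt0 : 0 < rho0 by rewrite invr_gt0 ltr0n.
have B0_ge1 : 1 <= 2%:R * B0.
  by rewrite mulrDr ler_wpDl ?mulr_ge0 ?exprn_ge0 // -natrM ler1n.
have B0L_gt0 : 0 < (2%:R * B0) ^+ L by rewrite exprn_gt0 // (lt_le_trans ltr01).
have rho1_gt0 : 0 < rho1 by rewrite divr_gt0.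
exists (Num.min rho1 del); split; first by rewrite lt_min rho1_gt0.
pose rs (u : R[i]) : seq R[i] := sval (closed_field_poly_normal (specialize P u)).
(* The sign turns the monic factors [x - r_i] into [r_i - x]. *)
exists (fun u => (-1) ^+ n * eval_u u (lead_coef P)), (fun i u => (rs u)`_i).
move=> u u0 ur.
have u_rho1 : `|u| < rho1%:C%C by apply: (lt_le_trans ur); rewrite lecR ge_min lexx.
have lcu : eval_u u (lead_coef P) != 0.
  by apply: hdel => //; apply: (lt_le_trans ur); rewrite lecR ge_min lexx orbT.
set alpha := _ * _; pose r (i : 'I_n) := (rs u)`_i.
have alpha0 : alpha != 0 by rewrite mulf_neq0 // signr_eq0.
have spE : specialize P u = alpha *: \prod_(i < n) ((r i)%:P - 'X).
  have szu : size (specialize P u) = size P by apply: size_map_poly_id0.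
  have lcE : lead_coef (specialize P u) = eval_u u (lead_coef P).
    by rewrite -[specialize P u]/(map_poly (eval_u u) P) lead_coef_map_eq.
  have := svalP (closed_field_poly_normal (specialize P u)); rewrite -/(rs u) lcE => h.
  have szrs : size (rs u) = n.
    move: szu; rewrite n_deg h size_scale // size_prod_XsubC => <- //.
  rewrite h (big_nth 0) szrs big_mkord /alpha.
  rewrite [in RHS](eq_bigr (fun i : 'I_n => (-1)%:P * ('X - (r i)%:P))); last first.
    by move=> i _; rewrite mul_polyC scaleN1r opprB.
  rewrite big_split /= prodr_const card_ord -rmorphXn mul_polyC scalerA.
  by rewrite mulrAC -expr2 sqrr_sign mul1r.
pose w i := joukowski_inv (r i).
have w0 i : w i != 0 by have [] := joukowski_invP (r i).
have rE i : r i = (w i + (w i)^-1) / 2%:R by have [] := joukowski_invP (r i).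
have rho0C_gt0 : 0 < rho0%:C%C by rewrite ltcR.
have rho1C : rho1%:C%C = rho0%:C%C / (2%:R * (2%:R ^+ b + 2%:R)) ^+ L :> R[i].
  rewrite /rho1 fmorph_div; congr (_ / _).
  by rewrite /B0 !(rmorphXn, rmorphM, rmorphD, rmorph_nat).
have u_rho0 : `|u| <= rho0%:C%C.
  apply: ltW; apply: (lt_le_trans u_rho1); rewrite lecR /rho1.
  by rewrite ler_pdivrMr // ler_peMr ?(ltW rho0_gt0) // exprn_ege1.
have b_rho0 : b%:R * rho0%:C%C <= 4%:R^-1 :> R[i].
  have -> : b%:R * rho0%:C%C = (b%:R * rho0)%:C%C :> R[i] by rewrite rmorphM rmorph_nat.
  have -> : 4%:R^-1 = (4%:R^-1)%:C%C :> R[i] by rewrite fmorphV rmorph_nat.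
  rewrite lecR /rho0 natrM invfM mulrCA ler_piMr ?invr_ge0 //.
  by rewrite ler_pdivrMr ?ltr0n // mul1r ler_nat.
have lt41 : 4%:R^-1 < 1 :> R[i] by rewrite invf_lt1 ?ltr0n // ltr1n.
have b_u : b%:R * `|u| <= 4%:R^-1 by apply: le_trans b_rho0; rewrite ler_wpM2l.
have b_u1 : b%:R * `|u| < 1 by apply: le_lt_trans b_u lt41.
have u2 : 1 - u ^+ 2 != 0.
  have u1 : `|u| < 1.
    apply: (le_lt_trans u_rho0); rewrite -[1]/((1 : R)%:C%C) ltcR invf_lt1 ?ltr0n //.
    by rewrite ltr1n mulnS.
  rewrite subr_eq0 eq_sym; apply: contraTneq u1 => uu.
  have /eqP : `|u| ^+ 2 = 1 by rewrite -normrX uu normr1.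
  by rewrite pexpr_eq1 // => /eqP ->; rewrite ltxx.
set q := (1 - u ^+ 2) ^ _.
have q0 : q != 0 by rewrite expfz_neq0.
pose c0 := alpha / 2%:R ^+ n * \prod_i w i.
have detE z : `|z| = 1 ->
    \det (1%:M - u *: edge_mx X (volt_weight volt z)) =
    q * (alpha * \prod_i (r i - (z + z^-1) / 2%:R)).
  move=> z1; have z0 : z != 0 by rewrite -normr_eq0 z1 oner_eq0.
  rewrite (det_edge_bass a_free p_quot voltP) // -detP // spE hornerZ horner_prod.
  by congr (_ * (_ * _)); apply: eq_bigr => i _; rewrite !hornerE.
(* If [|w i| = 1], the determinant at [z = w i] would contain the factor [r i - (z + z^-1) / 2 = 0],
   whereas it does not vanish on the unit circle. *)
have v_lt1 i : `|(w i)^-1| < 1.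
  have [_ _ le1] := joukowski_invP (r i); rewrite lt_neqAle le1 andbT.
  apply/eqP => e1; have w1 : `|w i| = 1 by rewrite -[w i]invrK normfV e1 invr1.
  have := det_edge_neq0 X volt w1 b_u1; rewrite detE // (bigD1 i) //= -rE subrr.
  by rewrite mul0r !mulr0 eqxx.
have detW z : `|z| = 1 ->
    \det (1%:M - u *: edge_mx X (volt_weight volt z)) =
    q * c0 * \prod_i ((1 - z * (w i)^-1) * (1 - z^-1 * (w i)^-1)).
  move=> z1; have z0 : z != 0 by rewrite -normr_eq0 z1 oner_eq0.
  rewrite detE // (eq_bigr (fun i => w i / 2%:R *
     ((1 - z * (w i)^-1) * (1 - z^-1 * (w i)^-1)))); last first.
    by move=> i _; rewrite {1}rE joukowski_factor.
  rewrite !big_split /= prodr_const card_ord exprVn /c0; ring.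
pose c := q * c0.
have cc0 : c != 0.
  have pw0 : \prod_i w i != 0 by apply/prodf_neq0 => i _.
  have n0 : (2%:R ^+ n : R[i])^-1 != 0 by rewrite invr_neq0 // expf_neq0 // pnatr_eq0.
  exact: mulf_neq0 q0 (mulf_neq0 (mulf_neq0 alpha0 n0) pw0).
have [Os hOs] := orbit_lists a_free p_quot s_lift voltP.
pose F M := \prod_(o <- Os M) (1 - u ^+ plen o).
have [zr zrP] : exists zr : nat -> R[i], forall N, (0 < N)%N -> N.-primitive_root (zr N).
  have hN N : exists z : R[i], (0 < N)%N -> N.-primitive_root z.
    case: N => [|N]; first by exists 0.
    by have [z hz] := closed_prim_root_exists R[i] (ltn0Sn N); exists z.
  by have [zr hzr] := choice hN; exists zr.
pose G N := \prod_(i < N) \det (1%:M - u *: edge_mx X (volt_weight volt (zr N ^+ i))).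
have hG N : (0 < N)%N -> G N = c ^+ N * \prod_i (1 - (w i)^-1 ^+ N) ^+ 2.
  move=> N0; have zp := zrP N N0; rewrite /G.
  rewrite (eq_bigr (fun k : 'I_N => c * \prod_i ((1 - zr N ^+ k * (w i)^-1) *
      (1 - (zr N ^+ k)^-1 * (w i)^-1)))); last first.
    by move=> k _; rewrite detW // normrX (norm_prim_root zp) expr1n.
  rewrite big_split /= prodr_const card_ord; congr (_ * _).
  rewrite exchange_big /=; apply: eq_bigr => i _.
  by rewrite big_split /= (prim_root_prod _ zp) (prim_root_prodV _ zp) expr2.
have primOs M o : o \in Os M -> primitive_orbits a o.
  by have [_ h _] := hOs M; move=> /h [].
have uniqOs M : uniq (Os M) by have [] := hOs M.
have hF M : 2%:R^-1 <= `|F M|.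
  have h : \sum_(o <- Os M) `|u ^+ plen o| <= 2%:R^-1.
    under eq_bigr do rewrite normrX.
    by apply: (sum_plen_half a_free p_quot s_lift voltP) => // o; apply: primOs.
  have h21 : 2%:R^-1 + 2%:R^-1 = 1 :> R[i] by field.
  apply: le_trans (norm_prod1B_ge _).
    by rewrite lerBrDr -[X in _ <= X]h21 lerD2l.
  by apply: (le_trans h); rewrite -[X in _ <= X]h21 lerDl invr_ge0.
pose kap := `|u| / rho0%:C%C.
have hGF M N : (0 < N)%N -> (M * L <= N)%N ->
    `|G N - F M ^+ N| <= kap ^+ M * (2%:R ^+ b + 2%:R) ^+ N.
  move=> N0 MLN; have [_ _ cnt] := hOs M.
  have br : b%:R * rho0%:C%C <= 1 :> R[i] := le_trans b_rho0 (ltW lt41).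
  have Sr : \sum_(o <- Os M) rho0%:C%C ^+ plen o <= 2%:R^-1 :> R[i].
    apply: (sum_plen_half a_free p_quot s_lift voltP) => //; last exact: ltW.
    by move=> o; apply: primOs.
  have := det_vs_orbits voltL (@plen_gt0 _ _) cnt (zrP N N0) MLN rho0C_gt0 u_rho0 br Sr.
  move=> /le_trans; apply; apply: ler_wpM2l; first by rewrite exprn_ge0 // divr_ge0 // ltW.
  by apply: exprD_superadditive => //; rewrite exprn_ge0.
have kapB : kap * (2%:R * (2%:R ^+ b + 2%:R)) ^+ L < 1.
  rewrite rho1C in u_rho1; rewrite /kap mulrAC ltr_pdivrMr // mul1r.
  by rewrite -ltr_pdivlMr // exprn_gt0 // mulr_gt0 // ltr_wpDl // exprn_ge0.
have /cvgrPdist_lt cvgF := @cvg_of_power_approx R[i] (@complex_expr_small R) c F G n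
  (fun i => (w i)^-1) L kap (2%:R ^+ b + 2%:R) cc0 v_lt1 (ltn0Sn _)
  (divr_ge0 (normr_ge0 u) (ltW rho0C_gt0))
  (addr_ge0 (exprn_ge0 _ (ler0n _ _)) (ler0n _ _)) kapB hG hF hGF.
have hlim : zeta_partial_prods a u --> (c : R[i]^o).
  apply: (zeta_partial_prods_cvg a_free p_quot s_lift voltP (Os := Os)) => //.
    by move=> M; have [h1 h2 _] := hOs M.
  by move=> e /cvgF [M0 _ h]; exists M0 => M MM; apply: h.
have pF := finite_subsets_proper (primitive_orbits a).
have limE : L2zeta_inv a u = c := norm_cvg_lim hlim.
split; [exact: alpha0 | exact: spE | exact: cvgP hlim | ].
by rewrite limE /c /c0 mulrA.
Qed.
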